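(* Let $S$ be a closed densely defined symmetric operator with equal defect numbers in a Hilbert space $\mathfrak{H}$ which commutes with a non-trivial fundamental symmetry $J$, and let $\{C_\alpha\}_{\alpha\in D}$ be the set of all $C$-symmetries of $S$. Let $(\mathcal{H},\Gamma_0,\Gamma_1)$ be a boundary triplet for $S^*$ such that the formulas $$\mathcal{C}_\alpha\Gamma_0 f=\Gamma_0C_\alpha f,\qquad \mathcal{C}_\alpha\Gamma_1 f=\Gamma_1C_\alpha f,\qquad \forall\alpha\in D,\ \forall f\in\mathcal{D}(S^* )$$ correctly define an operator family $\{\mathcal{C}_\alpha\}_{\alpha\in D}$ in $\mathcal{H}$, let $\mathcal{J}$ be the operator $\mathcal{C}_\alpha$ corresponding to $C_\alpha=J$, and let $M(\cdot)$ be the associated Weyl function of $S$. Then $A\in\Sigma_J^{\mathsf{st}}$ if and only if there is a $\mathcal{J}$-unitary operator $\mathcal{K}$ in $\mathcal{H}$ with $$A=S^*\upharpoonright\{f\in\mathcal{D}(S^* ) : \mathcal{K}\Omega_+f=\Omega_-f\},\qquad \Omega_\pm=\tfrac{1}{\sqrt2}(\Gamma_1\pm i\Gamma_0),$$ such that $\mathcal{K}$ has the $\mathcal{C}$-symmetry in the Krein space $(\mathcal{H},[\cdot,\cdot]_{\mathcal{J}})$ for some operator $\mathcal{C}$ with $[\mathcal{C},M(\cdot)]=0$; that is, there is a bounded operator $\mathcal{C}$ in $\mathcal{H}$ with $\mathcal{C}^2=I$, $\mathcal{J}\mathcal{C}>0$, $\mathcal{K}\mathcal{C}=\mathcal{C}\mathcal{K}$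 and $\mathcal{C}M(\lambda)=M(\lambda)\mathcal{C}$ for all $\lambda\in\mathbb{C}\setminus\mathbb{R}$.
   Context: $\mathfrak{H}$ is a Hilbert space with inner product $(\cdot,\cdot)$. A fundamental symmetry is a bounded operator $J$ with $J=J^*$, $J^2=I$; it is non-trivial if $J\neq\pm I$. For a bounded operator $C$ and an operator $A$, ''$A$ commutes with $C$'', written $[A,C]=0$, means $AC=CA$ (including equality of domains). For bounded $T$, $T>0$ means $T$ is self-adjoint and $(Tx,x)>0$ for all $x\neq0$. $\{C_\alpha\}_{\alpha\in D}$ denotes the set (indexed by a set $D$) of all bounded operators $C$ in $\mathfrak{H}$ with $C^2=I$, $JC>0$ and $SC=CS$. It contains $J$. Each such $C$ also commutes with $S^*$. An operator $A$ is $J$-self-adjoint if it is densely defined and $A^*J=JA$. $\Sigma_J$ is the set of $J$-self-adjoint extensions $A\supset S$. $\Sigma_J^{\mathsf{st}}$ (stable $C$-symmetry) is the set of $A\in\Sigma_J$ such that $[A,C_\alpha]=0$ for at least one $\alpha\in D$. A boundary triplet for $S^*$ is a triplet $(\mathcal{H},\Gamma_0,\Gamma_1)$, where $\mathcal{H}$ is a Hilbert space and $\Gamma_0,\Gamma_1:\mathcal{D}(S^* )\to\mathcal{H}$ are linear, such that $(S^*x,y)-(x,S^*y)=(\Gamma_1x,\Gamma_0y)_{\mathcal{H}}-(\Gamma_0x,\Gamma_1y)_{\mathcal{H}}$ for all $x,y\in\mathcal{D}(S^* )$ and $(\Gamma_0,\Gamma_1):\mathcal{D}(S^* )\to\mathcal{H}\oplus\mathcal{H}$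 is surjective. ''Correctly define'' means that for each $\alpha$ there is a single well-defined operator $\mathcal{C}_\alpha$ in $\mathcal{H}$ satisfying both formulas. $\mathcal{J}$ is a fundamental symmetry in $\mathcal{H}$, and $[x,y]_{\mathcal{J}}=(\mathcal{J}x,y)_{\mathcal{H}}$. A bounded, boundedly invertible operator $\mathcal{K}$ in $\mathcal{H}$ is $\mathcal{J}$-unitary if $\mathcal{K}^*\mathcal{J}\mathcal{K}=\mathcal{J}$. The Weyl function $M(\cdot)$ of $S$ associated with $(\mathcal{H},\Gamma_0,\Gamma_1)$ is the function with values bounded operators in $\mathcal{H}$ determined by $M(\mu)\Gamma_0f_\mu=\Gamma_1f_\mu$ for all $f_\mu\in\ker(S^*-\mu I)$, $\mu\in\mathbb{C}\setminus\mathbb{R}$. *)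

(* Defs.v *)
From HB Require Import structures.
From mathcomp Require Import all_boot all_order all_algebra.
From mathcomp Require Import all_classical all_reals all_analysis.
From mathcomp Require Export complex.

Set Implicit Arguments.
Unset Strict Implicit.
Unset Printing Implicit Defensive.

Import Order.TTheory GRing.Theory Num.Theory.
Import numFieldNormedType.Exports.

Local Open Scope classical_set_scope.
Local Open Scope card_scope.
Local Open Scope ring_scope.

(* Positive definiteness of [inner] follows from [inner_norm].
   The inner product is linear in its first argument. *)
HB.mixin Record CompleteNormedModule_isHilbert (R : realType) H
    of CompleteNormedModule R[i] H := {
  inner : H -> H -> R[i];
  innerDZl : forall (a : R[i]) (x y z : H),
    inner (a *: x + y) z = a * inner x z + inner y z;
  inner_conj : forall x y : H, inner x y = Num.conj (inner y x);
  inner_norm : forall x : H, `|x| ^+ 2 = inner x x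
}.

#[short(type="hilbertType")]
HB.structure Definition Hilbert (R : realType) :=
  {H of CompleteNormedModule R[i] H & CompleteNormedModule_isHilbert R H}.

Section Operators.
Context {R : realType}.
Implicit Types (H : hilbertType R).

(* A possibly unbounded operator. The values of [opfun] outside [dom] are
   irrelevant, so operators are compared with [opeq], never with [=]. *)
Record operator (H : Type) := Operator { dom : set H; opfun :> H -> H }.

Definition everywhere (H : Type) (T : H -> H) : operator H := Operator setT T.

Definition opsub (H : Type) (A B : operator H) : Prop :=
  dom A `<=` dom B /\ forall x, dom A x -> B x = A x.

Definition opeq (H : Type) (A B : operator H) : Prop := opsub A B /\ opsub B A.

Definition opcomp (H : Type) (A B : operator H) : operator H :=
  Operator [set x | dom B x /\ dom A (B x)] (fun x => A (B x)).

Definition oprestr (H : Type) (A : operator H) (P : set H) : operator H :=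
  Operator (dom A `&` P) A.

Definition commutes (H : Type) (A : operator H) (C : H -> H) : Prop :=
  opeq (opcomp A (everywhere C)) (opcomp (everywhere C) A).

Definition linear_on (H G : lmodType R[i]) (V : set H) (f : H -> G) : Prop :=
  forall (a : R[i]) x y, V x -> V y -> f (a *: x + y) = a *: f x + f y.

Definition linear_operator H (A : operator H) : Prop :=
  [/\ dom A 0,
      forall (a : R[i]) x y, dom A x -> dom A y -> dom A (a *: x + y)
    & linear_on (dom A) A].

Definition densely_defined H (A : operator H) : Prop := dense (dom A).

Definition closed_operator H (A : operator H) : Prop :=
  closed [set p : H * H | dom A p.1 /\ p.2 = A p.1].

(* For densely defined [A] the vector [z] below is unique. *)
Definition adjoint H (A : operator H) : operator H :=
  let adj (y : H) := [set z : H | forall x, dom A x -> inner (A x) y = inner x z]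
  in Operator [set y | exists z, adj y z] (fun y => xget 0 (adj y)).

Definition symmetric_operator H (A : operator H) : Prop :=
  forall x y, dom A x -> dom A y -> inner (A x) y = inner x (A y).

Definition bounded_operator H (T : H -> H) : Prop :=
  linear T /\ exists c : R[i], forall x, `|T x| <= c * `|x|.

Definition self_adjoint H (A : operator H) : Prop := opeq (adjoint A) A.

Definition positive_operator H (T : H -> H) : Prop :=
  self_adjoint (everywhere T) /\ forall x, x != 0 -> 0 < inner (T x) x.

Definition orthonormal_basis H (V B : set H) : Prop :=
  [/\ B `<=` V,
      forall e, B e -> inner e e = 1,
      forall e e', B e -> B e' -> e != e' -> inner e e' = 0
    & forall x, V x -> (forall e, B e -> inner x e = 0) -> x = 0].

Definition same_hilbert_dim H (V W : set H) : Prop :=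
  exists B B' : set H,
    [/\ orthonormal_basis V B, orthonormal_basis W B' & B #= B'].

(* ker (A - mu I) *)
Definition ker_sub H (A : operator H) (mu : R[i]) : set H :=
  [set f | dom A f /\ A f = mu *: f].

(* Equality of the Hilbert dimensions of the defect subspaces ker (S^* -+ i I),
   as cardinalities of orthonormal bases, so that infinite ones are included. *)
Definition equal_defect_numbers H (S : operator H) : Prop :=
  same_hilbert_dim (ker_sub (adjoint S) 'i) (ker_sub (adjoint S) (- 'i)).

Definition fundamental_symmetry H (J : H -> H) : Prop :=
  [/\ bounded_operator J, self_adjoint (everywhere J) & J \o J =1 id].

Definition nontrivial_symmetry H (J : H -> H) : Prop :=
  ~ (J =1 id) /\ ~ (J =1 -%R).

(* The conditions on a C-symmetry that involve only the Krein space given by J. *)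
Definition C_operator H (J C : H -> H) : Prop :=
  [/\ bounded_operator C, C \o C =1 id & positive_operator (J \o C)].

Definition C_symmetry H (J : H -> H) (S : operator H) (C : H -> H) : Prop :=
  C_operator J C /\ commutes S C.

Definition J_self_adjoint H (J : H -> H) (A : operator H) : Prop :=
  densely_defined A /\ opeq (opcomp (adjoint A) (everywhere J)) (opcomp (everywhere J) A).

Definition Sigma_J H (J : H -> H) (S A : operator H) : Prop :=
  [/\ linear_operator A, J_self_adjoint J A & opsub S A].

Definition Sigma_J_st H (J : H -> H) (S : operator H)
    (D : Type) (C : D -> H -> H) (A : operator H) : Prop :=
  Sigma_J J S A /\ exists alpha : D, commutes A (C alpha).

Definition boundary_triplet H (G : hilbertType R) (S : operator H)
    (Gamma0 Gamma1 : H -> G) : Prop :=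
  let S' := adjoint S in
  [/\ linear_on (dom S') Gamma0, linear_on (dom S') Gamma1,
      forall x y, dom S' x -> dom S' y ->
        inner (S' x) y - inner x (S' y) =
        inner (Gamma1 x) (Gamma0 y) - inner (Gamma0 x) (Gamma1 y)
    & forall h0 h1 : G, exists f, [/\ dom S' f, Gamma0 f = h0 & Gamma1 f = h1]].

(* Only the values of [M] at non-real points matter. *)
Definition weyl_function H (G : hilbertType R) (S : operator H)
    (Gamma0 Gamma1 : H -> G) (M : R[i] -> G -> G) : Prop :=
  forall mu : R[i], mu \isn't Num.real ->
    bounded_operator (M mu) /\
    forall f, ker_sub (adjoint S) mu f -> M mu (Gamma0 f) = Gamma1 f.

Definition Omega_plus (H : Type) (G : hilbertType R) (Gamma0 Gamma1 : H -> G)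
    (f : H) : G := (sqrtC 2)^-1 *: (Gamma1 f + 'i *: Gamma0 f).

Definition Omega_minus (H : Type) (G : hilbertType R) (Gamma0 Gamma1 : H -> G)
    (f : H) : G := (sqrtC 2)^-1 *: (Gamma1 f - 'i *: Gamma0 f).

Definition boundedly_invertible H (K : H -> H) : Prop :=
  exists L : H -> H, [/\ bounded_operator L, cancel K L & cancel L K].

Definition J_unitary H (J K : H -> H) : Prop :=
  [/\ bounded_operator K, boundedly_invertible K
    & opeq (opcomp (adjoint (everywhere K)) (everywhere (J \o K))) (everywhere J)].

End Operators.

(* Main.v *)
(* On ker (S' - mu) the triplet gives the gamma field gam mu : G -> H, and an
   operator X with X S = S X is mirrored in G by T with Gamma_j X = T Gamma_j,
   hence X (gam mu h) = gam mu (T h); so T commutes with the Weyl function.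
   Positivity of calJ T follows from that of J X: the powers of t - calJ T do not
   grow faster than t ^+ n. Given A, the relation {(Omega_+ x, Omega_- x)} for x
   in dom A is hypermaximal neutral and T-invariant; in the definite metric given
   by calJ T it is an isometry with closed domain, and maximality makes it the
   graph of a calJ-unitary operator.

   Conversely, if T commutes with the Weyl function, Green's formula makes the map
   gam mu h |-> gam mu (calJ T h) symmetric on the span of the defect subspaces,
   and the same growth argument bounds it. Extended by the identity on the
   orthogonal complement, it is a positive operator commuting with the resolvents
   of ker Gamma0, hence with S, and J times it is the C-symmetry of S inducing T. *)

Require Import Defs.
From mathcomp Require Import all_boot all_order all_algebra.
From mathcomp Require Import all_classical all_reals all_analysis.
From mathcomp Require Import ring lra.
Import Order.TTheory GRing.Theory Num.Theory.
Import numFieldNormedType.Exports.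
Local Open Scope classical_set_scope.
Local Open Scope ring_scope.

Set Implicit Arguments.
Unset Strict Implicit.
Unset Printing Implicit Defensive.

(** * Hilbert space analysis *)

(** The obstacle in passing between [H] and [G] is that [gam mu] is bounded and bounded below but
    not isometric, so neither norm estimates nor positivity transfer directly. Rates of growth do.
    Therefore positivity of a symmetric [W] bounded by [t] is traded for the estimate
    [|t - W| <= t]: once the iterates of [t - W] grow at most like [t ^+ n] in a comparable norm,
    symmetry makes their norms log-convex and restores the sharp constant [t], whatever factor stood
    in front of [t ^+ n]. In the converse direction that factor even depends on the vector. There
    the resulting bound also yields single-valuedness of the lift, which is not clear beforehand
    because defect subspaces at different points may be linearly dependent. The pairs with [mu]
    conjugate to [lam] are exceptional: Green's formula then says nothing about the inner product of
    [gam mu h] and [gam lam k]. They are recovered by continuity along real shifts, which keep the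
    imaginary part and with it the resolvent bound. *)

Section RealNorm.
Context {R : realType}.
Implicit Types (z w : R[i]) (V : normedModType R[i]).

(* [`|x|] is an element of [R[i]]; this is its value in [R]. *)
Definition rnorm (V : normedZmodType R[i]) (x : V) : R := complex.Re `|x|.

Lemma rnormE (V : normedZmodType R[i]) (x : V) : `|x| = (rnorm x)%:C%C.
Proof. by rewrite /rnorm RRe_real // normr_real. Qed.

Lemma rnorm_ge0 (V : normedZmodType R[i]) (x : V) : 0 <= rnorm x.
Proof. by have := normr_ge0 x; rewrite rnormE lecR. Qed.

Lemma rnormD (V : normedZmodType R[i]) (x y : V) :
  rnorm (x + y) <= rnorm x + rnorm y.
Proof. by have := ler_normD x y; rewrite !rnormE -rmorphD lecR. Qed.

Lemma rnormN (V : normedZmodType R[i]) (x : V) : rnorm (- x) = rnorm x.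
Proof. by rewrite /rnorm normrN. Qed.

Lemma rnormB (V : normedZmodType R[i]) (x y : V) : rnorm (x - y) = rnorm (y - x).
Proof. by rewrite -rnormN opprB. Qed.

Lemma rnormB_tri (V : normedZmodType R[i]) (y x z : V) :
  rnorm (x - z) <= rnorm (x - y) + rnorm (y - z).
Proof. by apply: le_trans (rnormD _ _); rewrite addrA subrK. Qed.

Lemma rnorm0 (V : normedZmodType R[i]) : rnorm (0 : V) = 0.
Proof. by rewrite /rnorm normr0. Qed.

Lemma rnorm_eq0 (V : normedZmodType R[i]) (x : V) : rnorm x = 0 -> x = 0.
Proof. by move=> x0; apply/eqP; rewrite -normr_eq0 rnormE x0. Qed.

Lemma rnorm_small (V : normedZmodType R[i]) (x : V) :
  (forall e, 0 < e -> rnorm x < e) -> x = 0.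
Proof.
move=> h; apply: rnorm_eq0; apply/eqP; case: (eqVneq (rnorm x) 0) => // x0.
by have := h (rnorm x); rewrite lt_def x0 rnorm_ge0 ltxx => /(_ isT).
Qed.

Lemma rnormZ V z (x : V) : rnorm (z *: x) = rnorm z * rnorm x.
Proof.
by apply: complexI; rewrite rmorphM /= -!rnormE normrZ.
Qed.

Lemma rnormM z w : rnorm (z * w) = rnorm z * rnorm w.
Proof. by apply: complexI; rewrite rmorphM /= -!rnormE normrM. Qed.

Lemma rnormJ z : rnorm (Num.conj z) = rnorm z.
Proof. by rewrite /rnorm norm_conjC. Qed.

Lemma rnormR (r : R) : rnorm (r%:C%C) = `|r|.
Proof. by rewrite /rnorm normc_def /= expr0n addr0 sqrtr_sqr. Qed.

Lemma rnormi : rnorm ('i%C : R[i]) = 1.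
Proof. by rewrite /rnorm normc_def /= expr0n expr1n add0r sqrtr1. Qed.

Lemma real_complexD (a b : R) : (a + b)%:C%C = a%:C%C + b%:C%C.
Proof. exact: rmorphD. Qed.

Lemma real_complexN (a : R) : (- a)%:C%C = - a%:C%C.
Proof. exact: rmorphN. Qed.

Lemma real_complexM (a b : R) : (a * b)%:C%C = a%:C%C * b%:C%C.
Proof. exact: rmorphM. Qed.

Lemma real_complexX (a : R) n : (a ^+ n)%:C%C = a%:C%C ^+ n.
Proof. exact: rmorphXn. Qed.

Lemma real_complex_nat n : (n%:R : R)%:C%C = n%:R.
Proof. exact: rmorph_nat. Qed.

Definition real_complex_morphE := (real_complex_nat, real_complexX, real_complexN,
  real_complexD, real_complexM).

Lemma mul_conj_rnorm z : z * Num.conj z = (rnorm z ^+ 2)%:C%C.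
Proof. by rewrite -normCK rnormE rmorphXn. Qed.

Lemma ReD z w : complex.Re (z + w) = complex.Re z + complex.Re w.
Proof. by case: z w => [a b] [c d]. Qed.

Lemma ReN z : complex.Re (- z) = - complex.Re z.
Proof. by case: z. Qed.

Lemma ImD z w : complex.Im (z + w) = complex.Im z + complex.Im w.
Proof. by case: z w => [a b] [c d]. Qed.

Lemma ImN z : complex.Im (- z) = - complex.Im z.
Proof. by case: z. Qed.

Lemma ImZr (r : R) z : complex.Im (z * r%:C%C) = complex.Im z * r.
Proof. by case: z => [a b] /=; rewrite mulr0 add0r. Qed.

Lemma abs_Re_le z : `|complex.Re z| <= rnorm z.
Proof. by rewrite -lecR -rnormE; exact: normc_ge_Re. Qed.

Lemma abs_Im_le z : `|complex.Im z| <= rnorm z.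
Proof.
by have := abs_Re_le (z * 'i%C); rewrite ReiNIm normrN rnormM rnormi mulr1.
Qed.

Lemma Im_conjC z : complex.Im (Num.conj z) = - complex.Im z.
Proof. by case: z. Qed.

Lemma nonrealE z : (z \isn't Num.real) = (complex.Im z != 0).
Proof. by case: z => a b; rewrite complex_real. Qed.

End RealNorm.

Section LinearMaps.
Context {K : pzRingType} {V W : lmodType K} (f : V -> W) (lf : linear f).

Lemma lin0 : f 0 = 0.
Proof. by have := lf (-1) 0 0; rewrite !scaleN1r oppr0 addr0 addNr. Qed.

Lemma linD x y : f (x + y) = f x + f y.
Proof. by have := lf 1 x y; rewrite !scale1r. Qed.

Lemma linZ a x : f (a *: x) = a *: f x.
Proof. by have := lf a x 0; rewrite !addr0 lin0 addr0. Qed.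

Lemma linN x : f (- x) = - f x.
Proof. by rewrite -scaleN1r linZ scaleN1r. Qed.

Lemma linB x y : f (x - y) = f x - f y.
Proof. by rewrite linD linN. Qed.

End LinearMaps.

Section LinearOn.
Context {R : realType}.

Definition linear_set (V : lmodType R[i]) (E : set V) : Prop :=
  E 0 /\ forall (a : R[i]) x y, E x -> E y -> E (a *: x + y).

Context (V W : lmodType R[i]) (E : set V) (f : V -> W).
Context (sE : linear_set E) (lf : linear_on E f).

Lemma subspZ a x : E x -> E (a *: x).
Proof. by move=> Ex; rewrite -[_ *: _]addr0; apply: sE.2 => //; exact: sE.1. Qed.

Lemma subspD x y : E x -> E y -> E (x + y).
Proof. by move=> Ex Ey; rewrite -[x]scale1r; apply: sE.2. Qed.

Lemma subspN x : E x -> E (- x).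
Proof. by rewrite -scaleN1r; exact: subspZ. Qed.

Lemma subspB x y : E x -> E y -> E (x - y).
Proof. by move=> Ex Ey; apply: subspD => //; exact: subspN. Qed.

Lemma lin_on0 : f 0 = 0.
Proof.
have := lf (-1) sE.1 sE.1; by rewrite !scaleN1r oppr0 addr0 addNr.
Qed.

Lemma lin_onD x y : E x -> E y -> f (x + y) = f x + f y.
Proof. by move=> Ex Ey; have := lf 1 Ex Ey; rewrite !scale1r. Qed.

Lemma lin_onZ a x : E x -> f (a *: x) = a *: f x.
Proof. by move=> Ex; have := lf a Ex sE.1; rewrite !addr0 lin_on0 addr0. Qed.

Lemma lin_onN x : E x -> f (- x) = - f x.
Proof. by move=> Ex; rewrite -scaleN1r lin_onZ // scaleN1r. Qed.

Lemma lin_onB x y : E x -> E y -> f (x - y) = f x - f y.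
Proof. by move=> Ex Ey; rewrite lin_onD ?lin_onN //; exact: subspN. Qed.

End LinearOn.

Section InnerProduct.
Context {R : realType} {H : hilbertType R}.
Implicit Types (x y z : H) (a : R[i]).

Lemma inner0l z : inner 0 z = 0.
Proof.
by have := inner_conj (0:H) z; have := innerDZl (-1) (0:H) 0 z;
  rewrite scaler0 addr0 mulN1r addNr.
Qed.

Lemma innerDl x y z : inner (x + y) z = inner x z + inner y z.
Proof. by have := innerDZl 1 x y z; rewrite scale1r mul1r. Qed.

Lemma innerZl a x z : inner (a *: x) z = a * inner x z.
Proof. by have := innerDZl a x 0 z; rewrite addr0 inner0l addr0. Qed.

Lemma innerNl x z : inner (- x) z = - inner x z.
Proof. by rewrite -scaleN1r innerZl mulN1r. Qed.

Lemma innerBl x y z : inner (x - y) z = inner x z - inner y z.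
Proof. by rewrite innerDl innerNl. Qed.

Lemma inner0r z : inner z 0 = 0.
Proof. by rewrite inner_conj inner0l conjC0. Qed.

Lemma innerDr x y z : inner x (y + z) = inner x y + inner x z.
Proof. by rewrite inner_conj innerDl rmorphD /= -!inner_conj. Qed.

Lemma innerZr a x z : inner x (a *: z) = Num.conj a * inner x z.
Proof. by rewrite inner_conj innerZl rmorphM /= -inner_conj. Qed.

Lemma innerNr x z : inner x (- z) = - inner x z.
Proof. by rewrite inner_conj innerNl rmorphN /= -inner_conj. Qed.

Lemma innerBr x y z : inner x (y - z) = inner x y - inner x z.
Proof. by rewrite innerDr innerNr. Qed.

Lemma inner_self x : inner x x = (rnorm x ^+ 2)%:C%C.
Proof. by rewrite -inner_norm rnormE rmorphXn. Qed.

Lemma rnorm_sqr x : rnorm x ^+ 2 = complex.Re (inner x x).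
Proof. by rewrite inner_self. Qed.

Lemma inner_self_eq0 x : inner x x = 0 -> x = 0.
Proof.
rewrite inner_self => /(@complexI R (rnorm x ^+ 2) 0) /eqP.
by rewrite sqrf_eq0 => /eqP /rnorm_eq0.
Qed.

Lemma inner_ext x y : (forall z, inner z x = inner z y) -> x = y.
Proof.
move=> h; apply/eqP; rewrite -subr_eq0; apply/eqP; apply: inner_self_eq0.
by rewrite innerBr h subrr.
Qed.

Lemma pythagoras x y : inner x y = 0 -> rnorm (x + y) ^+ 2 = rnorm x ^+ 2 + rnorm y ^+ 2.
Proof.
move=> xy; rewrite !rnorm_sqr innerDl !innerDr xy (inner_conj y) xy conjC0.
by rewrite addr0 add0r ReD.
Qed.

End InnerProduct.

Section CauchySchwarz.
Context {R : realType}.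

(* Nonnegativity of the quadratic [p - 2 t A + t^2 A q], where [A] stands for
   [|b x y|^2] and [t * b x y] for the coefficient of [y]. *)
Lemma quad_nonneg (p q A : R) : 0 <= q -> 0 <= A ->
  (forall t : R, 0 <= p - 2 * t * A + t ^+ 2 * A * q) -> A <= p * q.
Proof.
move=> q0 A0 h; have p0 : 0 <= p by have := h 0; rewrite mulr0 mul0r expr0n !mul0r subr0 addr0.
case: (eqVneq A 0) => [->|An0]; first exact: mulr_ge0.
have Ap : 0 < A by rewrite lt_def An0.
case: (eqVneq q 0) => [q00|qn0].
  have := h ((p + 1) / (2 * A)).
  rewrite q00 mulr0 addr0 (_ : 2 * _ * A = p + 1); last by field.
  lra.
have := h q^-1; have qp : 0 < q by rewrite lt_def qn0.
rewrite (_ : p - _ + _ = p - A / q); last by field.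
by rewrite subr_ge0 ler_pdivrMr.
Qed.

Lemma form_cauchy_schwarz (V : lmodType R[i]) (b : V -> V -> R[i]) :
  (forall a x y z, b (a *: x + y) z = a * b x z + b y z) ->
  (forall x y, b x y = Num.conj (b y x)) -> (forall x, 0 <= complex.Re (b x x)) ->
  forall x y, rnorm (b x y) ^+ 2 <= complex.Re (b x x) * complex.Re (b y y).
Proof.
move=> bl bc b0 x y; apply: quad_nonneg => //; first exact: sqr_ge0.
move=> t; set c := b x y; set s := - (t%:C%C * c).
have := b0 (s *: y + x).
have br a u v w : b w (a *: u + v) = Num.conj a * b w u + b w v.
  by rewrite bc bl rmorphD rmorphM /= -!bc.
rewrite bl !br (bc y x) -/c /s.
have cJ : Num.conj c = c^*%C by [].
case: (b x x) (b y y) (bc x x) (bc y y) => [p p'] [q q'] [p'0] [q'0].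
have -> : p' = 0 by lra. have -> : q' = 0 by lra.
have -> : rnorm c ^+ 2 = complex.Re c ^+ 2 + complex.Im c ^+ 2.
  by apply: complexI; rewrite add_Re2_Im2 rnormE rmorphXn.
clear s; rewrite cJ; case: c cJ => [u v] cJ; clear cJ.
rewrite [Num.conj _](_ : _ = (- (t%:C * (u +i* v)))^*)%C //.
by rewrite /=; congr (_ <= _); ring.
Qed.

Lemma cauchy_schwarz (H : hilbertType R) (x y : H) :
  rnorm (inner x y) <= rnorm x * rnorm y.
Proof.
have := form_cauchy_schwarz (b := @inner R H) (@innerDZl _ _) (@inner_conj _ _) _ x y.
rewrite !inner_self /= -exprMn ler_sqr ?nnegrE ?mulr_ge0 ?rnorm_ge0 //.
by apply=> z; rewrite inner_self /= sqr_ge0.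
Qed.

End CauchySchwarz.

(** * Approximation and orthogonal projection *)

Section HilbertAnalysis.
Context {R : realType}.

Definition inv_succ (n : nat) : R := n.+1%:R^-1.

Lemma inv_succ_gt0 n : 0 < inv_succ n.
Proof. by rewrite invr_gt0 ltr0n. Qed.

Lemma inv_succ_small (e : R) : 0 < e ->
  exists N, forall n, (N <= n)%N -> inv_succ n < e.
Proof.
move=> e0; have [N _ h] := near_infty_natSinv_lt (PosNum e0).
by exists N => n Nn; have := h n Nn.
Qed.

Lemma rnorm_complete (H : completeNormedModType R[i]) (u : nat -> H) :
  (forall e : R, 0 < e -> exists N, forall m n,
     (N <= m)%N -> (N <= n)%N -> rnorm (u m - u n) < e) ->
  exists l, forall e : R, 0 < e ->
    exists N, forall n, (N <= n)%N -> rnorm (u n - l) < e.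
Proof.
move=> cu; have cvgu : cvg (u @ \oo).
  apply: cauchy_cvg; apply/cauchy_ballP => e e0.
  have eR : e \is Num.real by rewrite gtr0_real.
  have e0' : 0 < complex.Re e by rewrite -ltcR RRe_real.
  have [N hN] := cu _ e0'.
  exists ([set x | exists2 n, (N <= n)%N & u n = x], [set x | exists2 n, (N <= n)%N & u n = x]).
    by split; exists N => // n /= Nn; exists n.
  move=> [x y] [/= [m Nm <-] [n Nn <-]].
  rewrite -ball_normE /ball_ /= rnormE -(RRe_real eR) ltcR.
  exact: hN.
exists (lim (u @ \oo)) => e e0.
have /cvgrPdist_lt /(_ (e%:C)%C) := cvgu.
rewrite ltcR => /(_ e0) [N _ h]; exists N => n Nn.
by have := h n Nn; rewrite /= rnormE ltcR rnormB.
Qed.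

Context {H : hilbertType R}.
Implicit Types (x y z u v w : H) (E : set H).

Definition adherent E x := forall e : R, 0 < e -> exists y, E y /\ rnorm (x - y) < e.

Lemma dense_adherent E : dense E -> forall x, adherent E x.
Proof.
move=> dE x e e0.
have [] := dE (ball x (e%:C)%C).
- by exists x; apply: ballxx; rewrite ltcR.
- exact: ball_open.
move=> y [xy Ey]; exists y; split=> //.
by move: xy; rewrite -ball_normE /ball_ /= rnormE ltcR.
Qed.

Lemma adherent_orth E x u : adherent E x ->
  (forall y, E y -> inner y u = 0) -> inner x u = 0.
Proof.
move=> aE Eu; apply: rnorm_small => e e0.
have d0 : 0 < e / (rnorm u + 1) by rewrite divr_gt0 // ltr_wpDl ?rnorm_ge0.
have [y [Ey xy]] := aE _ d0.
have -> : inner x u = inner (x - y) u by rewrite innerBl (Eu y Ey) subr0.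
apply: le_lt_trans (cauchy_schwarz _ _) _.
have u0 := rnorm_ge0 u.
apply: le_lt_trans (_ : _ <= e / (rnorm u + 1) * rnorm u) _.
  by rewrite ler_wpM2r // ltW.
rewrite -mulrA gtr_pMr // mulrC ltr_pdivrMr; lra.
Qed.

Lemma dense_orth E u : (forall x, adherent E x) ->
  (forall y, E y -> inner y u = 0) -> u = 0.
Proof.
by move=> dE Eu; apply: inner_self_eq0; apply: adherent_orth Eu.
Qed.

(** Used with [f] the difference of the two sides of an identity that is known on a dense set. *)
Lemma lipschitz_adherent (V : normedZmodType R[i]) (f : H -> V) c E x :
  (forall x y, rnorm (f x - f y) <= c * rnorm (x - y)) ->
  (forall y, E y -> f y = 0) -> adherent E x -> f x = 0.
Proof.
move=> lf Ef aE; apply: rnorm_small => e e0.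
have c0 : 0 < `|c| + 1 by rewrite ltr_wpDl.
have [y [Ey xy]] := aE _ (divr_gt0 e0 c0).
have := lf x y; rewrite (Ef y Ey) subr0 => h; apply: (le_lt_trans h).
have xy0 := rnorm_ge0 (x - y).
apply: le_lt_trans (_ : _ <= (`|c| + 1) * rnorm (x - y)) _.
  by rewrite ler_wpM2r //; have := ler_norm c; lra.
by rewrite mulrC -ltr_pdivlMr.
Qed.

Lemma parallelogram x y :
  rnorm (x + y) ^+ 2 + rnorm (x - y) ^+ 2 = 2 * rnorm x ^+ 2 + 2 * rnorm y ^+ 2 :> R.
Proof.
by rewrite !rnorm_sqr !(innerDl, innerDr, innerNl, innerNr) !(ReD, ReN); ring.
Qed.

Lemma rnorm_sub_line (t : R) w y (c := inner w y) :
  rnorm (w - (t%:C%C * c) *: y) ^+ 2 =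
  rnorm w ^+ 2 - 2 * t * rnorm c ^+ 2 + t ^+ 2 * rnorm c ^+ 2 * rnorm y ^+ 2 :> R.
Proof.
apply: complexI; rewrite -inner_self innerBl !innerBr !innerZl !innerZr !inner_self.
rewrite (inner_conj y) -/c !real_complex_morphE.
have := mul_conj_rnorm c; rewrite real_complexX => <-.
rewrite rmorphM /= (_ : Num.conj (t%:C%C : R[i]) = t%:C%C); last exact: conjc_real.
ring.
Qed.

(* The limit of a minimizing sequence for the distance from [z] to [E] is the
   orthogonal projection of [z]. *)
Lemma double_orthogonal_adherent E z : linear_set E ->
  (forall u, (forall y, E y -> inner y u = 0) -> inner z u = 0) -> adherent E z.
Proof.
move=> sE hz.
pose D := [set rnorm (z - y) ^+ 2 | y in E].
have lbD : lbound D 0 by move=> _ [y _ <-]; exact: sqr_ge0.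
have infD : has_inf D.
  by split; [exists (rnorm (z - 0) ^+ 2); exists 0; [exact: sE.1|] | exists 0].
have le_d y : E y -> inf D <= rnorm (z - y) ^+ 2.
  by move=> Ey; apply: ge_inf; [exists 0 | exists y].
have /choice [y_ hy] : forall n : nat, exists y,
    E y /\ rnorm (z - y) ^+ 2 < inf D + inv_succ n.
  move=> n; have [_ [y Ey <-] h] := inf_adherent (inv_succ_gt0 n) infD.
  by exists y.
(* The midpoint of [y_ m] and [y_ n] lies in [E], so the parallelogram law turns near-minimality
   into the Cauchy property. *)
have cauchy_y m n : rnorm (y_ m - y_ n) ^+ 2 <= 2 * (inv_succ m + inv_succ n).
  have [Em hm] := hy m; have [En hn] := hy n.
  have := parallelogram (z - y_ m) (z - y_ n).
  have := le_d _ (subspZ sE (2^-1) (subspD sE Em En)).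
  have -> : z - y_ m + (z - y_ n) = 2 *: (z - 2^-1 *: (y_ m + y_ n)).
    by rewrite scalerBr scalerA divff ?pnatr_eq0 // scale1r scaler_nat mulr2n opprD addrACA.
  have -> : z - y_ m - (z - y_ n) = - (y_ m - y_ n).
    by rewrite opprB addrC subrKA opprB.
  rewrite rnormN rnormZ exprMn.
  have -> : rnorm (2 : R[i]) = 2.
    by rewrite -real_complex_nat rnormR normr_nat.
  rewrite [2 ^+ 2](_ : _ = 4); last by ring.
  have arith (a b c d f i j : R) : a < d + i -> b < d + j -> d <= f ->
    4 * f + c = 2 * a + 2 * b -> c <= 2 * (i + j) by move=> *; lra.
  exact: arith hm hn.
have [p hp] : exists l, forall e : R, 0 < e ->
    exists N, forall n, (N <= n)%N -> rnorm (y_ n - l) < e.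
  apply: rnorm_complete => e e0.
  have e20 : 0 < e ^+ 2 / 4 by rewrite divr_gt0 ?exprn_gt0.
  have [N hN] := inv_succ_small e20; exists N => m n Nm Nn.
  rewrite -(ltr_pXn2r (n := 2)) // ?nnegrE ?rnorm_ge0 ?(ltW e0) //.
  apply: le_lt_trans (cauchy_y m n) _.
  by have := hN m Nm; have := hN n Nn; lra.
have adhp : adherent E p.
  move=> e e0; have [N hN] := hp e e0; exists (y_ N); split; first by case: (hy N).
  by rewrite rnormB hN.
have orthp y : E y -> inner y (z - p) = 0.
  move=> Ey.
  (* Moving [y_ n] along [y] cannot bring the squared distance below [inf D]; [quad_nonneg] with the
     excess over [inf D] as [p] gives orthogonality up to that excess. *)
  have step n : rnorm (inner (z - y_ n) y) ^+ 2 <= inv_succ n * rnorm y ^+ 2.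
    have [En hn] := hy n.
    apply: le_trans (_ : _ <= (rnorm (z - y_ n) ^+ 2 - inf D) * rnorm y ^+ 2) _; last first.
      by rewrite ler_wpM2r ?sqr_ge0 //; lra.
    apply: quad_nonneg; rewrite ?sqr_ge0 // => t.
    set c := inner (z - y_ n) y.
    have := le_d _ (sE.2 (t%:C * c)%C y (y_ n) Ey En).
    have -> : rnorm (z - ((t%:C * c)%C *: y + y_ n)) ^+ 2 =
       rnorm (z - y_ n) ^+ 2 - 2 * t * rnorm c ^+ 2 + t ^+ 2 * rnorm c ^+ 2 * rnorm y ^+ 2.
      by rewrite opprD addrCA addrC rnorm_sub_line.
    by lra.
  apply: rnorm_small => e e0; rewrite inner_conj rnormJ.
  have := rnorm_ge0 y => y0.
  have d0 : 0 < e / 2 / (rnorm y + 1) by rewrite !divr_gt0 //; lra.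
  have dd0 : 0 < (e / 2 / (rnorm y + 1)) ^+ 2 by rewrite exprn_gt0.
  have [N1 h1] := hp _ d0; have [N2 h2] := inv_succ_small dd0.
  set N := maxn N1 N2.
  have {}h1 := h1 N (leq_maxl _ _); have {}h2 := h2 N (leq_maxr _ _).
  have -> : z - p = (z - y_ N) + (y_ N - p) by rewrite addrA subrK.
  rewrite innerDl; apply: le_lt_trans (rnormD _ _) _.
  have {}h1 : rnorm (inner (y_ N - p) y) <= e / 2 / (rnorm y + 1) * rnorm y.
    apply: le_trans (cauchy_schwarz _ _) _; rewrite ler_wpM2r //; exact: ltW.
  have {}h2 : rnorm (inner (z - y_ N) y) <= e / 2 / (rnorm y + 1) * rnorm y.
    have dn : 0 <= e / 2 / (rnorm y + 1) * rnorm y by rewrite mulr_ge0 // ltW.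
    rewrite -(ler_pXn2r (n := 2)) // ?nnegrE ?rnorm_ge0 //.
    apply: le_trans (step N) _; rewrite [leRHS]exprMn ler_wpM2r ?sqr_ge0 //; exact: ltW.
  have : e / 2 / (rnorm y + 1) * rnorm y < e / 2.
    by rewrite -mulrA gtr_pMr ?divr_gt0 // mulrC ltr_pdivrMr; lra.
  lra.
have z0 : z - p = 0.
  by apply: inner_self_eq0; rewrite innerBl (hz _ orthp) (adherent_orth adhp orthp) subr0.
by move/subr0_eq: z0 => ->.
Qed.

End HilbertAnalysis.

Arguments adjoint : simpl never.

Section UniformBoundedness.
Context {R : realType} {G : hilbertType R}.

(* Sokal's gliding hump: walk by steps [+- 4^-n k_n / |k_n|], the sign being
   chosen so that [inner _ k_n] is not decreased. *)
Lemma weakly_bounded (F : set G) :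
  (forall h, exists c : R, forall k, F k -> rnorm (inner h k) <= c) ->
  exists c : R, forall k, F k -> rnorm k <= c.
Proof.
move=> wF; apply/not_existsP => nF.
(* The factor [4 ^+ n] cancels the step length [4^-n], so the n-th hump still exceeds [n.+1]. *)
have /choice [k hk] : forall n : nat, exists k, F k /\ 4 ^+ n * n.+1%:R < rnorm k.
  move=> n; have /existsNP [k /not_implyP [Fk hk]] := nF (4 ^+ n * n.+1%:R).
  by exists k; split => //; rewrite ltNge; apply/negP.
have kpos n : 0 < rnorm (k n).
  by apply: le_lt_trans (hk n).2; rewrite mulr_ge0 // exprn_ge0.
pose q n : R := 4^-1 ^+ n.
have qpos n : 0 < q n by rewrite exprn_gt0 // invr_gt0.
have qS n : q n.+1 = q n / 4 by rewrite /q exprSr.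
pose xi n : G := (q n / rnorm (k n))%:C%C *: k n.
have nxi n : rnorm (xi n) = q n.
  rewrite rnormZ rnormR ger0_norm ?divr_ge0 ?ltW //.
  by rewrite divfK // gt_eqF.
have ixi n : rnorm (inner (xi n) (k n)) = q n * rnorm (k n).
  rewrite innerZl rnormM rnormR ger0_norm ?divr_ge0 ?ltW // inner_self rnormR ger0_norm ?sqr_ge0 //.
  have /gt_eqF := kpos n; move/negbT => kn0; by field.
pose step n (x : G) := if rnorm (inner (x - xi n) (k n)) <= rnorm (inner (x + xi n) (k n))
  then x + xi n else x - xi n.
pose x := fix x n := if n is n'.+1 then step n' (x n') else 0.
have xS n : x n.+1 = step n (x n) by [].
have x_hump n : q n * rnorm (k n) <= rnorm (inner (x n.+1) (k n)).
  rewrite xS -ixi.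
  have : rnorm (inner (xi n) (k n) + inner (xi n) (k n)) <=
     rnorm (inner (x n + xi n) (k n)) + rnorm (inner (x n - xi n) (k n)).
    have -> : inner (xi n) (k n) + inner (xi n) (k n) =
        inner (x n + xi n) (k n) - inner (x n - xi n) (k n).
      by rewrite innerBl innerDl; ring.
    by apply: le_trans (rnormD _ _) _; rewrite rnormN.
  rewrite -mulr2n -mulr_natl rnormM -real_complex_nat rnormR normr_nat /step.
  case: ifP => [|/negbT]; rewrite -?ltNge => h1 h2; lra.
have x_step n : rnorm (x n.+1 - x n) <= q n.
  rewrite xS /step -nxi; case: ifP => _; rewrite addrAC subrr add0r //.
  by rewrite rnormN.
have x_dist n m : rnorm (x (n + m)%N - x n) <= 4 / 3 * (q n - q (n + m)%N).
  elim: m => [|m IH]; first by rewrite addn0 !subrr rnorm0 mulr0.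
  apply: le_trans (rnormB_tri (x (n + m)%N) _ _) _.
  have := x_step (n + m)%N; rewrite addnS qS => h; lra.
have x_dist' n m : rnorm (x (n + m)%N - x n) <= 4 / 3 * q n.
  by apply: le_trans (x_dist n m) _; have := qpos (n + m)%N; lra.
have q_inv n : q n <= inv_succ n.
  rewrite /q exprVn /inv_succ lef_pV2 ?posrE ?exprn_gt0 //.
  rewrite -natrX ler_nat; elim: n => // n IH.
  rewrite expnS; apply: leq_trans (_ : 4 * n.+1 <= _)%N; rewrite ?leq_mul2l ?IH ?orbT //.
  by rewrite (mulnDl 1 3) mul1n -[n.+2]addn1 leq_add2l.
have [l hl] : exists l, forall e : R, 0 < e ->
    exists N, forall n, (N <= n)%N -> rnorm (x n - l) < e.
  apply: rnorm_complete => e e0; have e4 : 0 < e / 4 by lra.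
  have [N hN] := inv_succ_small e4; exists N => m n Nm Nn.
  apply: le_lt_trans (rnormB_tri (x N) _ _) _.
  rewrite [rnorm (x N - _)]rnormB -{1}(subnKC Nm) -(subnKC Nn).
  have := x_dist' N (m - N)%N; have := x_dist' N (n - N)%N.
  by have := q_inv N; have := hN N (leqnn N); lra.
have l_dist n : rnorm (l - x n) <= 4 / 3 * q n.
  apply/ler_addgt0Pr => e e0; have [N hN] := hl e e0.
  apply: le_trans (rnormB_tri (x (n + N)%N) _ _) _.
  rewrite [rnorm (l - _)]rnormB.
  by have := hN _ (leq_addl n N); have := x_dist' n N; lra.
have [c hc] := wF l.
(* The steps after the n-th add up to at most [4 / 3 * q n.+1 = q n / 3], so at least two thirds of
   the hump survive at [l]; this is the factor [3 / 2]. *)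
have bound n : n.+1%:R <= 3 / 2 * c.
  have h1 := hc _ (hk n).1.
  have h2 : rnorm (inner (l - x n.+1) (k n)) <= 4 / 3 * q n.+1 * rnorm (k n).
    by apply: le_trans (cauchy_schwarz _ _) _; rewrite ler_wpM2r ?rnorm_ge0.
  have h3 := x_hump n.
  have h4 : rnorm (inner (x n.+1) (k n)) <=
      rnorm (inner l (k n)) + rnorm (inner (l - x n.+1) (k n)).
    have -> : inner (x n.+1) (k n) = inner l (k n) - inner (l - x n.+1) (k n).
      by rewrite innerBl; ring.
    by apply: le_trans (rnormD _ _) _; rewrite rnormN.
  have h5 : (n.+1%:R : R) <= q n * rnorm (k n).
    rewrite mulrC /q exprVn ler_pdivlMr ?exprn_gt0 // mulrC; exact: ltW (hk n).2.
  rewrite qS in h2; lra.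
have c0 : 0 < 3 / 2 * c by apply: lt_le_trans (bound 0); rewrite ltr0n.
have := bound (Num.truncn (3 / 2 * c)).
by rewrite leNgt truncnS_gt.
Qed.

End UniformBoundedness.

Section BoundedMaps.
Context {R : realType}.
Implicit Types H G : hilbertType R.

(** The operators induced in [G] come as bare functions; a formal adjoint is what shows them to be
    linear. *)
Lemma adjoint_pair_linear H G (T : H -> G) (T' : G -> H) :
  (forall x y, inner (T x) y = inner x (T' y)) -> linear T.
Proof.
move=> adj a x y; apply/esym/inner_ext => z; rewrite inner_conj [RHS]inner_conj.
by congr Num.conj; rewrite innerDl innerZl !adj innerDl innerZl.
Qed.

(** The image of the unit ball is weakly bounded, because [inner (T x) h] is at most [rnorm (T' h)]
    there. The gamma field and the induced operators in [G] get their bounds in this way. *)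
Lemma hellinger_toeplitz H G (T : H -> G) (T' : G -> H) :
  (forall x y, inner (T x) y = inner x (T' y)) ->
  exists c : R, 0 <= c /\ forall x, rnorm (T x) <= c * rnorm x.
Proof.
move=> adj; have lT := adjoint_pair_linear adj.
have [c hc] : exists c : R, forall k, [set T x | x in [set x | rnorm x <= 1]] k -> rnorm k <= c.
  apply: weakly_bounded => h; exists (rnorm (T' h)) => _ [x /= x1 <-].
  rewrite inner_conj rnormJ adj; apply: le_trans (cauchy_schwarz _ _) _.
  by rewrite ler_piMl // rnorm_ge0.
have c0 : 0 <= c.
  by apply: le_trans (hc (T 0) _); [exact: rnorm_ge0 | exists 0 => //=; rewrite rnorm0].
exists c; split=> // x; have [/rnorm_eq0 ->|x0] := eqVneq (rnorm x) 0.
  by rewrite (lin0 lT) !rnorm0 mulr0.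
have xp : 0 < rnorm x by rewrite lt_def x0 rnorm_ge0.
rewrite -ler_pdivrMr //.
have ix : rnorm ((rnorm x)^-1%:C%C *: x) = 1.
  by rewrite rnormZ rnormR ger0_norm ?mulVf // invr_ge0 ltW.
have : rnorm (T ((rnorm x)^-1%:C%C *: x)) <= c.
  by apply: hc; exists ((rnorm x)^-1%:C%C *: x) => //=; rewrite ix.
rewrite (linZ lT) rnormZ rnormR [`|_|]ger0_norm; last by rewrite invr_ge0 ltW.
by rewrite mulrC.
Qed.

Lemma bounded_operatorP H (T : H -> H) : bounded_operator T <->
  linear T /\ exists c : R, 0 <= c /\ forall x, rnorm (T x) <= c * rnorm x.
Proof.
split=> [[lT [c hc]]|[lT [c [c0 hc]]]]; split=> //.
  exists (rnorm c); split=> [|x]; first exact: rnorm_ge0.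
  have h := hc x; rewrite -lecR real_complexM -!rnormE -[X in _ * X]normr_id -normrM.
  by rewrite ger0_norm // (le_trans _ h).
exists (c%:C)%C => x; rewrite !rnormE -real_complexM lecR; exact: hc.
Qed.

Lemma adjointP H (A : operator H) y : dom (adjoint A) y ->
  forall x, dom A x -> inner (A x) y = inner x (adjoint A y).
Proof. by move=> /(xgetPex 0). Qed.

(** Density enters in the second component: [adjoint] picks some admissible vector, and density
    makes it the given [z]. *)
Lemma adjointI H (A : operator H) y z : densely_defined A ->
  (forall x, dom A x -> inner (A x) y = inner x z) ->
  dom (adjoint A) y /\ adjoint A y = z.
Proof.
move=> dA h; have dy : dom (adjoint A) y by exists z.
split=> //; apply/eqP; rewrite -subr_eq0; apply/eqP.
apply: (dense_orth (dense_adherent dA)) => x Ax.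
by rewrite innerBr -(adjointP dy Ax) (h x Ax) subrr.
Qed.

Lemma adjoint_everywhere H (T T' : H -> H) :
  (forall x y, inner (T x) y = inner x (T' y)) ->
  forall y, dom (adjoint (everywhere T)) y /\ adjoint (everywhere T) y = T' y.
Proof.
move=> adj y; apply: adjointI => [U [x Ux] _|x _ /=]; last exact: adj.
by exists x.
Qed.

Lemma self_adjoint_everywhere H (T : H -> H) :
  self_adjoint (everywhere T) <-> forall x y, inner (T x) y = inner x (T y).
Proof.
split=> [[_ [sT eT]] x y|sym].
  by have := adjointP (sT y I) (I : dom (everywhere T) x); rewrite (eT y I).
have adjT := adjoint_everywhere sym.
by split; split => [y _|y _] //=; have [] := adjT y.
Qed.

End BoundedMaps.

Section Extension.
Context {R : realType} {H : hilbertType R}.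

Lemma adherentP (E : set H) x : adherent E x ->
  exists u : nat -> H, forall n, E (u n) /\ rnorm (x - u n) < inv_succ n.
Proof.
move=> aE; have /choice [u hu] : forall n : nat, exists y, E y /\ rnorm (x - y) < inv_succ n.
  by move=> n; exact: aE (inv_succ_gt0 n).
by exists u.
Qed.

(** [W] is a relation because in the applications single-valuedness is not known in advance. It
    comes out of the bound, which forces [y = 0] from [W 0 y]. *)
Lemma bounded_extension (W : H -> H -> Prop) (c : R) : 0 <= c ->
  (forall a x y x' y', W x y -> W x' y' -> W (a *: x + x') (a *: y + y')) ->
  (forall x y, W x y -> rnorm y <= c * rnorm x) ->
  (forall x, adherent [set x | exists y, W x y] x) ->
  exists B : H -> H,
    [/\ linear B, forall x, rnorm (B x) <= c * rnorm x & forall x y, W x y -> B x = y].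
Proof.
move=> c0 lW bW dW.
pose lim x y := forall e : R, 0 < e -> exists x' y',
  [/\ W x' y', rnorm (x - x') < e & rnorm (y - y') < e].
have WB x y x' y' : W x y -> W x' y' -> W (x' - x) (y' - y).
  by move=> w w'; have := lW (-1) _ _ _ _ w w'; rewrite !scaleN1r ![- _ + _]addrC.
have ex_lim x : exists y, lim x y.
  have [u hu] := adherentP (dW x).
  have /choice [v hv] : forall n, exists y, W (u n) y by move=> n; case: (hu n).
  have [l hl] : exists l, forall e : R, 0 < e ->
      exists N, forall n, (N <= n)%N -> rnorm (v n - l) < e.
    apply: rnorm_complete => e e0; have d0 : 0 < e / 2 / (c + 1).
      by rewrite !divr_gt0 //; lra.
    have [N hN] := inv_succ_small d0; exists N => m n Nm Nn.
    apply: le_lt_trans (bW _ _ (WB _ _ _ _ (hv n) (hv m))) _.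
    have hm : rnorm (u m - x) < e / 2 / (c + 1).
      by rewrite rnormB; apply: lt_trans (hu m).2 (hN m Nm).
    have hn : rnorm (x - u n) < e / 2 / (c + 1) by apply: lt_trans (hu n).2 (hN n Nn).
    have : rnorm (u m - u n) <= e / (c + 1).
      apply: le_trans (rnormB_tri x _ _) _.
      rewrite [e / (c + 1)](_ : _ = e / 2 / (c + 1) + e / 2 / (c + 1)); last by field; lra.
      by apply: ltW; exact: ltrD.
    move=> h; apply: le_lt_trans (_ : _ <= c * (e / (c + 1))) _; first by rewrite ler_wpM2l.
    rewrite mulrCA gtr_pMr // ltr_pdivrMr; lra.
  exists l => e e0; have [N1 h1] := hl e e0; have [N2 h2] := inv_succ_small e0.
  exists (u (maxn N1 N2)), (v (maxn N1 N2)); split=> //.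
  - by apply: lt_trans (hu _).2 (h2 _ (leq_maxr _ _)).
  - by rewrite rnormB; apply: h1; exact: leq_maxl.
have lim_bound x y : lim x y -> rnorm y <= c * rnorm x.
  move=> h; apply/ler_addgt0Pr => e e0.
  have d0 : 0 < e / (c + 1) by rewrite divr_gt0 //; lra.
  have [x' [y' [w hx hy]]] := h _ d0.
  have h1 : rnorm y <= rnorm (y - y') + rnorm y' by rewrite -{1}(subrK y' y) rnormD.
  have h2 : rnorm x' <= rnorm (x - x') + rnorm x.
    by rewrite [rnorm (x - x')]rnormB -{1}(subrK x x') rnormD.
  have h3 := bW _ _ w.
  have h4 : c * rnorm x' <= c * (e / (c + 1) + rnorm x).
    by rewrite ler_wpM2l //; lra.
  have h5 : e = c * (e / (c + 1)) + e / (c + 1) :> R by field; lra.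
  rewrite mulrDr in h4; lra.
have lim_lin a x y x' y' : lim x y -> lim x' y' -> lim (a *: x + x') (a *: y + y').
  move=> h h' e e0; have a0 : 0 < rnorm a + 1 by rewrite ltr_wpDl // rnorm_ge0.
  have d0 : 0 < e / (rnorm a + 1) by rewrite divr_gt0.
  have [u [v [w hu hv]]] := h _ d0; have [u' [v' [w' hu' hv']]] := h' _ d0.
  have est (p q p' q' : H) : rnorm (p - q) < e / (rnorm a + 1) ->
      rnorm (p' - q') < e / (rnorm a + 1) ->
      rnorm (a *: p + p' - (a *: q + q')) < e.
    move=> h1 h2; rewrite opprD addrACA -scalerBr.
    apply: le_lt_trans (rnormD _ _) _; rewrite rnormZ.
    have : rnorm a * rnorm (p - q) <= rnorm a * (e / (rnorm a + 1)).
      by rewrite ler_wpM2l ?rnorm_ge0 // ltW.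
    have : e = rnorm a * (e / (rnorm a + 1)) + e / (rnorm a + 1) :> R by field; lra.
    lra.
  by exists (a *: u + u'), (a *: v + v'); split; [exact: lW | exact: est | exact: est].
have lim_uniq x y y' : lim x y -> lim x y' -> y = y'.
  move=> h h'; apply/eqP; rewrite -subr_eq0; apply/eqP.
  apply: rnorm_eq0; apply/eqP; rewrite eq_le rnorm_ge0 andbT.
  have := lim_bound _ _ (lim_lin (-1) _ _ _ _ h' h).
  by rewrite !scaleN1r !(addrC (- _)) subrr rnorm0 mulr0.
have limW x y : W x y -> lim x y.
  by move=> w e e0; exists x, y; rewrite !subrr rnorm0; split.
have /choice [B hB] := ex_lim.
exists B; split=> [a x y|x|x y w].
- by apply: lim_uniq (hB _) _; exact: lim_lin.
- exact: lim_bound.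
- exact: lim_uniq (hB x) (limW _ _ w).
Qed.

End Extension.

(** * Ranges of closed symmetric operators shifted by a non-real number *)

Section SymmetricRange.
Context {R : realType} {H : hilbertType R}.
Variables (P : set H) (A : H -> H) (mu : R[i]).
Hypothesis P_linear : linear_set P.
Hypothesis A_linear : linear_on P A.
Hypothesis A_symmetric : forall x y, P x -> P y -> inner (A x) y = inner x (A y).
Hypothesis mu_nonreal : complex.Im mu != 0.

(** The imaginary part of [inner (A x - mu *: x) x] is exactly
    [- (complex.Im mu * rnorm x ^+ 2)]. *)
Lemma symmetric_lower_bound x : P x ->
  `|complex.Im mu| * rnorm x <= rnorm (A x - mu *: x).
Proof.
move=> Px; have im : complex.Im (inner (A x - mu *: x) x) = - (complex.Im mu * rnorm x ^+ 2).
  have im0 : complex.Im (inner (A x) x) = 0.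
    by have := congr1 (@complex.Im R) (inner_conj (A x) x); rewrite Im_conjC A_symmetric //; lra.
  by rewrite innerBl innerZl inner_self ImD ImN im0 add0r ImZr.
have := abs_Im_le (inner (A x - mu *: x) x); rewrite im normrN normrM => h.
have {h} := le_trans h (cauchy_schwarz _ _).
rewrite [`|rnorm x ^+ 2|]ger0_norm ?sqr_ge0 // expr2 mulrA => h.
have [x0|x0] := eqVneq (rnorm x) 0; first by rewrite x0 mulr0 rnorm_ge0.
by rewrite -(ler_pM2r (_ : 0 < rnorm x)) // lt_def x0 rnorm_ge0.
Qed.

(** The lower bound makes the preimages of an approximating sequence Cauchy, and closedness of the
    graph identifies their limit. It serves both [S] and the extension with domain [kerGamma0]. *)
Lemma symmetric_range :
  (forall u w, (forall e : R, 0 < e ->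
     exists x, [/\ P x, rnorm (u - x) < e & rnorm (w - A x) < e]) -> P u /\ A u = w) ->
  forall z, (forall v, (forall x, P x -> inner (A x - mu *: x) v = 0) -> inner z v = 0) ->
  exists u, P u /\ A u - mu *: u = z.
Proof.
move=> clA z hz.
pose E := [set A x - mu *: x | x in P].
have linE a x y : P x -> P y -> A (a *: x + y) - mu *: (a *: x + y) =
    a *: (A x - mu *: x) + (A y - mu *: y).
  move=> Px Py; rewrite A_linear // scalerBr scalerDr opprD addrACA.
  by rewrite scalerA mulrC -scalerA.
have sE : linear_set E.
  split; first by exists 0; [exact: P_linear.1 | rewrite (lin_on0 P_linear A_linear) scaler0 subrr].
  move=> a _ _ [x Px <-] [y Py <-]; exists (a *: x + y); first exact: P_linear.2.
  exact: linE.
have aE : adherent E z.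
  by apply: double_orthogonal_adherent => // u hu; apply: hz => x Px; apply: hu; exists x.
have [v hv] := adherentP aE.
have /choice [u hu] : forall n, exists x, P x /\ A x - mu *: x = v n.
  by move=> n; have [[x Px <-] _] := hv n; exists x.
have m0 : 0 < `|complex.Im mu| by rewrite normr_gt0.
have [l hl] : exists l, forall e : R, 0 < e ->
    exists N, forall n, (N <= n)%N -> rnorm (u n - l) < e.
  apply: rnorm_complete => e e0; have d0 : 0 < e * `|complex.Im mu| / 2.
    by rewrite divr_gt0 // mulr_gt0.
  have [N hN] := inv_succ_small d0; exists N => m n Nm Nn.
  rewrite -(ltr_pM2l m0).
  apply: le_lt_trans (symmetric_lower_bound (subspB P_linear (hu m).1 (hu n).1)) _.
  have [Pm um] := hu m; have [Pn un] := hu n.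
  have := linE (-1) (u n) (u m) Pn Pm; rewrite !scaleN1r !(addrC (- _)) => ->.
  rewrite um un; apply: le_lt_trans (rnormB_tri z _ _) _; rewrite rnormB.
  have := lt_trans (hv m).2 (hN m Nm); have := lt_trans (hv n).2 (hN n Nn); lra.
have [Pl Al] : P l /\ A l = z + mu *: l.
  apply: clA => e e0; have k0 : 0 < rnorm mu + 1 by rewrite ltr_wpDl // rnorm_ge0.
  have d0 : 0 < e / (rnorm mu + 1) by rewrite divr_gt0.
  have [N1 h1] := hl _ d0; have [N2 h2] := inv_succ_small d0.
  set n := maxn N1 N2; have {}h1 := h1 n (leq_maxl _ _); have {}h2 := h2 n (leq_maxr _ _).
  have h3 := lt_trans (hv n).2 h2.
  have e1 : e = rnorm mu * (e / (rnorm mu + 1)) + e / (rnorm mu + 1) :> R by field; lra.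
  have mu0 : 0 <= rnorm mu by exact: rnorm_ge0.
  have h4 : rnorm mu * rnorm (l - u n) <= rnorm mu * (e / (rnorm mu + 1)).
    by rewrite ler_wpM2l // ltW // rnormB.
  have h5 : 0 <= rnorm mu * (e / (rnorm mu + 1)) by rewrite mulr_ge0 // ltW.
  exists (u n); split; first exact: (hu n).1.
    by rewrite rnormB; lra.
  have -> : z + mu *: l - A (u n) = (z - v n) + mu *: (l - u n).
    rewrite -(hu n).2 scalerBr opprB -addrA -[RHS]addrA; congr (z + _).
    by rewrite [RHS]addrC addrA subrK.
  by apply: le_lt_trans (rnormD _ _) _; rewrite rnormZ; lra.
by exists l; split=> //; rewrite Al addrK.
Qed.

End SymmetricRange.

(** * Iterates of symmetric operators and positivity *)

Section SymmetricPowers.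
Context {R : realType} {H : hilbertType R}.

(* The norms [|x n|] are log-convex, so a first ratio exceeding [b] would force
   them to grow faster than [b ^+ n]. *)
Lemma symmetric_orbit_bound (x : nat -> H) (b c : R) : 0 <= b ->
  (forall m n, inner (x m.+1) (x n) = inner (x m) (x n.+1)) ->
  (forall n, rnorm (x n) <= c * b ^+ n) -> rnorm (x 1%N) <= b * rnorm (x 0%N).
Proof.
move=> b0 sx gx; rewrite leNgt; apply/negP => h.
set a := fun n => rnorm (x n); have h' : b * a 0 < a 1 by [].
have a_ge0 n : 0 <= a n by exact: rnorm_ge0.
have convex n : a n.+1 ^+ 2 <= a n * a n.+2.
  have := cauchy_schwarz (x n) (x n.+2); rewrite -sx inner_self rnormR.
  by rewrite ger0_norm ?sqr_ge0.
have a0 : 0 < a 0.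
  rewrite lt_def a_ge0 andbT; apply/eqP => a00.
  have := convex 0; rewrite a00 mul0r => a1.
  have : a 1 ^+ 2 == 0 by rewrite eq_le a1 sqr_ge0.
  by rewrite sqrf_eq0 => /eqP a10; move: h'; rewrite a00 a10 mulr0 ltxx.
set r := a 1 / a 0; have br : b < r by rewrite ltr_pdivlMr.
have r0 : 0 < r by apply: le_lt_trans br.
have growth n : 0 < a n /\ r * a n <= a n.+1.
  elim: n => [|n [an IH]]; first by split=> //; rewrite /r divfK // gt_eqF.
  have an1 : 0 < a n.+1 by apply: lt_le_trans IH; exact: mulr_gt0.
  split=> //; rewrite -(ler_pM2l an); apply: le_trans (convex n).
  by rewrite mulrCA expr2 mulrA ler_wpM2r // ltW.
have pow n : r ^+ n * a 0 <= c * b ^+ n.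
  apply: le_trans (gx n); elim: n => [|n IH]; first by rewrite mul1r.
  apply: le_trans (growth n).2; rewrite exprS -mulrA ler_wpM2l //; exact: ltW.
have [b00|bn0] := eqVneq b 0.
  by have := pow 1%N; rewrite b00 !expr1 mulr0 leNgt mulr_gt0.
have bp : 0 < b by rewrite lt_def bn0.
set d := r / b - 1; have d0 : 0 < d by rewrite subr_gt0 ltr_pdivlMr // mul1r.
(* Linear growth of the powers of [r / b] already contradicts their bound [c / a 0]. *)
have bernoulli n : 1 + n%:R * d <= (r / b) ^+ n.
  elim: n => [|n IH]; first by rewrite mul0r addr0.
  rewrite exprS (_ : r / b = 1 + d); last by rewrite /d; ring.
  rewrite (_ : r / b = 1 + d) in IH; last by rewrite /d; ring.
  apply: le_trans (_ : (1 + d) * (1 + n%:R * d) <= _); last by rewrite ler_wpM2l //; lra.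
  have : 0 <= n%:R * (d * d) by rewrite mulr_ge0 // mulr_ge0 // ltW.
  rewrite -natr1; lra.
have bound n : (n%:R : R) <= c / a 0 / d.
  rewrite ler_pdivlMr // ler_pdivlMr //.
  have : (r / b) ^+ n * a 0 <= c.
    by rewrite exprMn exprVn mulrAC ler_pdivrMr ?exprn_gt0.
  have : (1 + n%:R * d) * a 0 <= (r / b) ^+ n * a 0 by rewrite ler_wpM2r // ltW.
  lra.
have := bound (Num.truncn (c / a 0 / d)).+1.
by rewrite leNgt truncnS_gt.
Qed.

Variables (T : H -> H) (t : R).
Hypothesis T_sym : forall x y, inner (T x) y = inner x (T y).
Let B x := t%:C%C *: x - T x.

Lemma inner_complement x :
  complex.Re (inner (B x) x) = t * rnorm x ^+ 2 - complex.Re (inner (T x) x).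
Proof. by rewrite /B innerBl innerZl inner_self ReD ReN -real_complexM. Qed.

(** With [complement_bound] as converse, this exchanges positivity for a norm bound on [t - T], the
    form that can be iterated and carried along an intertwining map. *)
Lemma positive_of_complement :
  (forall x, rnorm (B x) <= t * rnorm x) -> forall x, 0 <= complex.Re (inner (T x) x).
Proof.
move=> hB x; have := inner_complement x.
have := le_trans (abs_Re_le _) (cauchy_schwarz (B x) x).
have : rnorm (B x) * rnorm x <= t * rnorm x * rnorm x by rewrite ler_wpM2r ?rnorm_ge0.
have := ler_norm (complex.Re (inner (B x) x)).
rewrite -mulrA -expr2; lra.
Qed.

(** Both [B] and [t - B] are nonnegative. Cauchy-Schwarz for the form of [B] at [x] and [B x] bounds
    the fourth power of [rnorm (B x)] by [t * rnorm x ^+ 2] times [t * rnorm (B x) ^+ 2]. *)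
Lemma complement_bound : 0 <= t -> (forall x, 0 <= complex.Re (inner (T x) x)) ->
  (forall x, rnorm (T x) <= t * rnorm x) -> forall x, rnorm (B x) <= t * rnorm x.
Proof.
move=> t0 posT bT x; have lT := adjoint_pair_linear T_sym.
have symB y z : inner (B y) z = inner y (B z).
  rewrite /B innerBl innerBr innerZl innerZr T_sym.
  by rewrite (_ : Num.conj (t%:C%C : R[i]) = t%:C%C) //; exact: conjc_real.
have upB y : complex.Re (inner (B y) y) <= t * rnorm y ^+ 2.
  by rewrite inner_complement; have := posT y; lra.
have posB y : 0 <= complex.Re (inner (B y) y).
  rewrite inner_complement; have := le_trans (abs_Re_le _) (cauchy_schwarz (T y) y).
  have : rnorm (T y) * rnorm y <= t * rnorm y * rnorm y by rewrite ler_wpM2r ?rnorm_ge0.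
  have := ler_norm (complex.Re (inner (T y) y)); rewrite -mulrA -expr2; lra.
have := form_cauchy_schwarz (b := fun y z => inner (B y) z) _ _ posB x (B x).
rewrite inner_self rnormR [`|_|]ger0_norm ?sqr_ge0 // => h.
have {}h : (rnorm (B x) ^+ 2) ^+ 2 <= t * rnorm x ^+ 2 * (t * rnorm (B x) ^+ 2).
  apply: le_trans (h _ _) _ => [a y z w|y z|].
  - rewrite -innerDZl; congr inner; rewrite /B (linD lT) (linZ lT) scalerDr opprD addrACA.
    by rewrite scalerBr !scalerA mulrC.
  - by rewrite symB inner_conj.
  - exact: ler_pM.
have [->|n0] := eqVneq (rnorm (B x)) 0; first by rewrite mulr_ge0 ?rnorm_ge0.
have np : 0 < rnorm (B x) ^+ 2 by rewrite exprn_gt0 // lt_def n0 rnorm_ge0.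
rewrite -(ler_pXn2r (n := 2)) ?nnegrE ?rnorm_ge0 // ?mulr_ge0 ?rnorm_ge0 //.
rewrite -(ler_pM2r np) -expr2; apply: le_trans h _.
by rewrite exprMn le_eqVlt; apply/orP; left; apply/eqP; ring.
Qed.

End SymmetricPowers.

(** * Operators in Krein spaces *)

Section CommutingOperators.
Context {R : realType} {H : hilbertType R}.

Lemma commutes_dom (A : operator H) (X : H -> H) : commutes A X ->
  forall x, dom A x -> dom A (X x) /\ A (X x) = X (A x).
Proof.
by move=> [_ [sd e]] x dx; have [_ dX] := sd x (conj dx I); have := e x (conj dx I).
Qed.

(** For an involution one inclusion suffices: if [X x] is in [dom A], then so is [x = X (X x)]. *)
Lemma commutes_involution (A : operator H) (X : H -> H) : X \o X =1 id ->
  (forall x, dom A x -> dom A (X x) /\ A (X x) = X (A x)) -> commutes A X.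
Proof.
move=> XX cX; split; split=> x /=.
- by move=> [_ dx]; split=> //; have [+ _] := cX _ dx; rewrite [X (X x)]XX.
- move=> [_ dx]; have [+ _] := cX _ dx; rewrite [X (X x)]XX => dx'.
  by have [_ ->] := cX _ dx'.
- by move=> [dx _]; split=> //; have [] := cX _ dx.
- by move=> [dx _]; have [] := cX _ dx.
Qed.

Lemma commutes_everywhere (A X : H -> H) :
  commutes (everywhere A) X <-> forall x, A (X x) = X (A x).
Proof.
split=> [cX x|cX]; first by have [_] := commutes_dom cX (I : dom (everywhere A) x).
by split; split=> // x _ /=; rewrite cX.
Qed.

(** Strictness comes from injectivity: if the form of [T] vanishes at [x], Cauchy-Schwarz at [x] and
    [T x] gives [T x = 0]. *)
Lemma positive_operatorI (T : H -> H) :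
  (forall x y, inner (T x) y = inner x (T y)) -> injective T ->
  (forall x, 0 <= complex.Re (inner (T x) x)) -> positive_operator T.
Proof.
move=> symT injT posT; split; first exact/self_adjoint_everywhere.
have lT := adjoint_pair_linear symT.
move=> x x0; have realT : complex.Im (inner (T x) x) = 0.
  by have := congr1 (@complex.Im R) (inner_conj (T x) x); rewrite Im_conjC symT; lra.
rewrite ltcE realT eqxx /= lt_def posT andbT; apply/eqP => T0.
have Tx0 : T x = 0.
  apply: inner_self_eq0; apply: rnorm_eq0; apply/eqP.
  rewrite -sqrf_eq0 eq_le sqr_ge0 andbT.
  have := form_cauchy_schwarz (b := fun y z => inner (T y) z) _ _ posT x (T x).
  rewrite T0 mul0r; apply=> [a y z w|y z].
    by rewrite (linD lT) (linZ lT) innerDl innerZl.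
  by rewrite symT inner_conj.
by case/eqP: x0; apply: injT; rewrite Tx0 (lin0 lT).
Qed.

Lemma positive_operatorE (T : H -> H) : positive_operator T ->
  (forall x y, inner (T x) y = inner x (T y)) /\
  forall x, 0 <= complex.Re (inner (T x) x).
Proof.
move=> [/self_adjoint_everywhere symT posT]; split=> // x.
have [->|x0] := eqVneq x 0; first by rewrite inner0r.
by have := posT x x0; rewrite ltcE => /andP [_ /ltW].
Qed.

End CommutingOperators.

Section KreinSpace.
Context {R : realType} {G : hilbertType R} (J : G -> G).
Hypothesis J_sym : forall x y, inner (J x) y = inner x (J y).
Hypothesis J_inv : J \o J =1 id.

Lemma J_linear : linear J.
Proof. exact: (adjoint_pair_linear J_sym). Qed.

Lemma J_isometry x : rnorm (J x) = rnorm x.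
Proof.
apply/eqP; rewrite -(eqrXn2 (n := 2)) ?rnorm_ge0 // !rnorm_sqr J_sym.
by rewrite [J (J x)]J_inv.
Qed.

Section COperator.
Variable T : G -> G.
Hypothesis T_inv : T \o T =1 id.
Hypothesis JT_pos : positive_operator (J \o T).

Lemma C_adjoint x y : inner (T x) y = inner x (J (T (J y))).
Proof.
have [sym _] := positive_operatorE JT_pos.
have -> : T x = J (J (T x)) by rewrite [RHS]J_inv.
by rewrite J_sym [LHS]sym.
Qed.

Lemma C_linear : linear T.
Proof. exact: (adjoint_pair_linear C_adjoint). Qed.

(* Cauchy-Schwarz for the form of [J T] at [x] and [(J T)^-1 x = T J x]. *)
Lemma C_coercive (c : R) : (forall x, rnorm (T x) <= c * rnorm x) ->
  forall x, rnorm x ^+ 2 <= c * complex.Re (inner (J (T x)) x).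
Proof.
move=> bT x; have [sym pos] := positive_operatorE JT_pos.
have JTV : J (T (T (J x))) = x by rewrite [T (T _)]T_inv [J (J x)]J_inv.
have := form_cauchy_schwarz (b := fun y z => inner (J (T y)) z) _ _ pos (T (J x)) x.
rewrite JTV inner_self rnormR [`|_|]ger0_norm ?sqr_ge0 // => h.
have {}h : (rnorm x ^+ 2) ^+ 2 <= c * rnorm x ^+ 2 * complex.Re (inner (J (T x)) x).
  apply: le_trans (h _ _) _ => [a y z w|y z|].
  - by rewrite (linD C_linear) (linZ C_linear) (linD J_linear) (linZ J_linear) innerDl innerZl.
  - by rewrite [LHS]sym inner_conj.
  rewrite ler_wpM2r ?pos //; apply: le_trans (ler_norm _) _; apply: le_trans (abs_Re_le _) _.
  apply: le_trans (cauchy_schwarz _ _) _; rewrite expr2 mulrCA ler_wpM2l ?rnorm_ge0 //.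
  by have := bT (J x); rewrite J_isometry.
have [x0|x0] := eqVneq (rnorm x) 0.
  by rewrite (rnorm_eq0 x0) inner0r rnorm0 expr0n mulr0.
have xp : 0 < rnorm x ^+ 2 by rewrite exprn_gt0 // lt_def x0 rnorm_ge0.
by rewrite -(ler_pM2l xp) -expr2 mulrCA mulrA.
Qed.

End COperator.

(** * Hypermaximal neutral relations *)

Section NeutralRelation.
Variables (L : G -> G -> Prop) (T : G -> G).
Hypothesis L_maximal : forall p q,
  L p q <-> forall a b, L a b -> inner a (J p) = inner b (J q).
Hypothesis L_inv : forall p q, L p q -> L (T p) (T q).
Hypothesis T_C : C_operator J T.

Lemma neutral_linear a p q p' q' : L p q -> L p' q' -> L (a *: p + p') (a *: q + q').
Proof.
move=> /L_maximal h /L_maximal h'; apply/L_maximal => u v Luv.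
by rewrite !J_linear !innerDr !innerZr (h _ _ Luv) (h' _ _ Luv).
Qed.

(** Neutrality of the pairs [(p, q)] and [(T p, T q)] against each other says that the forms of
    [J T] at [p] and at [q] agree. By [C_coercive] that form is equivalent to the square of the
    norm. *)
Lemma neutral_bound : exists k : R, [/\ 0 <= k,
  forall p q, L p q -> rnorm q <= k * rnorm p & forall p q, L p q -> rnorm p <= k * rnorm q].
Proof.
have [/bounded_operatorP [lT [c [c0 bT]]] TT JT] := T_C.
have [sym pos] := positive_operatorE JT.
have cc : 0 <= c * c by exact: mulr_ge0.
(* One factor [c] comes from coercivity, the other from the norm of [T]; [c * c + 1] is simply a
   number whose square dominates [c * c]. *)
have bound p q : inner (J (T p)) p = inner (J (T q)) q -> rnorm q <= (c * c + 1) * rnorm p.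
  move=> e; have hq : rnorm q ^+ 2 <= c * c * rnorm p ^+ 2.
    apply: le_trans (C_coercive TT JT bT q) _; rewrite -e -mulrA ler_wpM2l //.
    apply: le_trans (ler_norm _) _; apply: le_trans (abs_Re_le _) _.
    apply: le_trans (cauchy_schwarz _ _) _; rewrite J_isometry expr2 mulrA.
    by rewrite ler_wpM2r ?rnorm_ge0.
  have k0 : 0 <= (c * c + 1) * rnorm p by rewrite mulr_ge0 ?rnorm_ge0 //; lra.
  rewrite -(ler_pXn2r (n := 2)) ?nnegrE ?rnorm_ge0 //; apply: le_trans hq _.
  by rewrite exprMn ler_wpM2r ?sqr_ge0 //; nra.
have e p q : L p q -> inner (J (T p)) p = inner (J (T q)) q.
  move=> Lpq; rewrite [LHS]sym [RHS]sym.
  exact: ((L_maximal _ _).1 (L_inv Lpq) _ _ Lpq).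
exists (c * c + 1); split=> [|p q Lpq|p q Lpq]; first by lra.
  exact: (bound _ _ (e _ _ Lpq)).
exact: (bound _ _ (esym (e _ _ Lpq))).
Qed.

(** If [u] is orthogonal to the domain of [L], maximality gives [L (J u) 0], and the bound on the
    first component forces [u = 0]; so the domain is dense. For the continuous extension [K], every
    [(p, K p)] is still neutral against [L], hence belongs to it by maximality. *)
Lemma neutral_graph : exists K : G -> G,
  bounded_operator K /\ forall p q, L p q <-> K p = q.
Proof.
have [k [k0 bL bL']] := neutral_bound.
have dense_dom p : adherent [set p | exists q, L p q] p.
  apply: double_orthogonal_adherent.
    split; first by exists 0; apply/L_maximal => a b _; rewrite (lin0 J_linear) !inner0r.
    by move=> a x y [x' Lx] [y' Ly]; exists (a *: x' + y'); exact: neutral_linear.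
  move=> u hu; suff -> : u = 0 by rewrite inner0r.
  have /bL' : L (J u) 0.
    apply/L_maximal => a b Lab; rewrite [J (J u)]J_inv (lin0 J_linear) inner0r.
    by apply: hu; exists b.
  rewrite J_isometry rnorm0 mulr0 => u0.
  by apply: rnorm_eq0; apply/eqP; rewrite eq_le u0 rnorm_ge0.
have [K [lK bK LK]] := bounded_extension k0 neutral_linear bL dense_dom.
exists K; split; first by apply/bounded_operatorP; split=> //; exists k.
suff LK' p : L p (K p) by move=> p q; split=> [/LK //|<-].
apply/L_maximal => a b Lab; rewrite -!J_sym; apply/eqP; rewrite -subr_eq0; apply/eqP.
pose f x := inner (J a) x - inner (J b) (K x); rewrite -[LHS]/(f p).
apply: (lipschitz_adherent (f := f) (c := rnorm a + rnorm b * k)) (dense_dom p).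
  move=> x y; have -> : f x - f y = inner (J a) (x - y) - inner (J b) (K (x - y)).
    by rewrite /f (linB lK) !innerBr; ring.
  apply: le_trans (rnormD _ _) _; rewrite rnormN mulrDl.
  apply: lerD; first by apply: le_trans (cauchy_schwarz _ _) _; rewrite J_isometry.
  apply: le_trans (cauchy_schwarz _ _) _; rewrite J_isometry -mulrA.
  by rewrite ler_wpM2l ?rnorm_ge0.
move=> x [y Lxy]; rewrite /f (LK _ _ Lxy) !J_sym.
by apply/eqP; rewrite subr_eq0; apply/eqP/((L_maximal _ _).1 Lxy).
Qed.

End NeutralRelation.

(** The inverse [M] exhibits the adjoint of [K] as [J M J], defined everywhere, which settles the
    domains in the operator identity. *)
Lemma J_unitary_adjoint (K : G -> G) : J_unitary J K <->
  [/\ bounded_operator K, boundedly_invertible K &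
    forall x y, inner (K x) (J (K y)) = inner x (J y)].
Proof.
split=> [[bK iK [_ [sd e]]]|[bK iK adj]]; split=> //.
  move=> x y; have [_ dy] := sd y I; have /= <- := e y I.
  exact: (adjointP dy).
have [M [bM KM MK]] := iK.
have adjK : forall x y, inner (K x) y = inner x (J (M (J y))).
  by move=> x y; rewrite -adj MK [J (J y)]J_inv.
have dadj := adjoint_everywhere adjK.
have adjJK x : dom (adjoint (everywhere K)) (J (K x)) /\
    adjoint (everywhere K) (J (K x)) = J x.
  by have [dx ->] := dadj (J (K x)); rewrite [J (J _)]J_inv KM.
split; split=> x dx; rewrite /everywhere /=; have [dx' ex'] := adjJK x => //.
Qed.

Lemma maximal_neutral_J_unitary (L : G -> G -> Prop) (T : G -> G) :
  (forall p q, L p q <-> forall a b, L a b -> inner a (J p) = inner b (J q)) ->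
  (forall p q, L p q -> L (T p) (T q)) -> C_operator J T ->
  exists K : G -> G,
    [/\ J_unitary J K, forall p q, L p q <-> K p = q & forall p, K (T p) = T (K p)].
Proof.
move=> maxL invL CT.
have [K [bK LK]] := neutral_graph maxL invL CT.
(* The hypotheses are symmetric in the two components, so the converse relation is a graph as well,
   and its operator is the inverse of [K]. *)
have [M [bM LM]] : exists M, bounded_operator M /\ forall q p, L p q <-> M q = p.
  apply: (neutral_graph (L := fun q p => L p q) _ _ CT) => [q p|q p]; last exact: invL.
  by rewrite maxL; split=> h a b Lab; rewrite (h _ _ Lab).
have LKx p : L p (K p) by apply/LK.
exists K; split=> // [|p]; last by apply/LK/invL.
apply/J_unitary_adjoint; split=> //; last first.
  by move=> x y; rewrite ((maxL _ _).1 (LKx y) _ _ (LKx x)).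
exists M; split=> // [p|q]; first by apply/LM.
by apply/LK/LM.
Qed.

End KreinSpace.

(** * Boundary triplets *)

Lemma sub_swap (V : zmodType) (a b c d : V) : a - b = c - d -> c - a = d - b.
Proof.
by move/eqP; rewrite subr_eq => /eqP ->; rewrite opprD opprB addrCA addrA subrK.
Qed.

Section BoundaryTriplet.
Context {R : realType} {H : hilbertType R} (S : operator H).
Hypothesis S_linear : linear_operator S.
Hypothesis S_closed : closed_operator S.
Hypothesis S_dense : densely_defined S.
Hypothesis S_symmetric : symmetric_operator S.
Context {G : hilbertType R} (Gamma0 Gamma1 : H -> G).
Hypothesis Gamma_triplet : boundary_triplet S Gamma0 Gamma1.
Let S' := adjoint S.
Implicit Types (x y z u v w f g : H) (h k : G) (mu lam : R[i]).

Lemma inner_approx (a b u w : H) :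
  (forall e : R, 0 < e -> exists u' w',
    [/\ rnorm (u - u') < e, rnorm (w - w') < e & inner a u' = inner b w']) ->
  inner a u = inner b w.
Proof.
move=> ap; apply/eqP; rewrite -subr_eq0; apply/eqP/rnorm_small => e e0.
have a0 := rnorm_ge0 a; have b0 := rnorm_ge0 b.
have d0 : 0 < e / (rnorm a + rnorm b + 1) by rewrite divr_gt0 //; lra.
have [u' [w' [hu hw hab]]] := ap _ d0.
have -> : inner a u - inner b w = inner a (u - u') - inner b (w - w').
  by rewrite !innerBr hab; ring.
apply: le_lt_trans (rnormD _ _) _; rewrite rnormN.
have hu' := cauchy_schwarz a (u - u'); have hw' := cauchy_schwarz b (w - w').
set d := e / _ in d0 hu hw.
have hu2 : rnorm a * rnorm (u - u') <= rnorm a * d by rewrite ler_wpM2l // ltW.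
have hw2 : rnorm b * rnorm (w - w') <= rnorm b * d by rewrite ler_wpM2l // ltW.
have : e = rnorm a * d + rnorm b * d + d :> R by rewrite /d; field; lra.
lra.
Qed.

Lemma dom_linear_set : linear_set (dom S).
Proof. by case: S_linear => d0 dl _; split. Qed.

Lemma dom_linear_on : linear_on (dom S) S.
Proof. by case: S_linear. Qed.

Lemma adj_lin a x y : dom S' x -> dom S' y ->
  dom S' (a *: x + y) /\ S' (a *: x + y) = a *: S' x + S' y.
Proof.
move=> dx dy; apply: adjointI => // u du.
by rewrite !innerDr !innerZr -!(adjointP _ du).
Qed.

Lemma adj_linear_set : linear_set (dom S').
Proof.
split=> [|a x y dx dy]; last by have [] := adj_lin a dx dy.
by have [] := adjointI (y := 0) (z := 0) S_dense; first by move=> x _; rewrite !inner0r.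
Qed.

Lemma adj_linear : linear_on (dom S') S'.
Proof. by move=> a x y dx dy; have [] := adj_lin a dx dy. Qed.

Lemma adj_extends x : dom S x -> dom S' x /\ S' x = S x.
Proof. by move=> dx; apply: adjointI => // y dy; exact: S_symmetric. Qed.

Lemma adj_closed u w : (forall e : R, 0 < e ->
    exists x, [/\ dom S' x, rnorm (u - x) < e & rnorm (w - S' x) < e]) ->
  dom S' u /\ S' u = w.
Proof.
move=> ap; apply: adjointI => // x dx; apply: inner_approx => e e0.
have [y [dy uy wy]] := ap e e0; exists y, (S' y); split=> //.
exact: adjointP.
Qed.

Lemma green x y : dom S' x -> dom S' y ->
  inner (S' x) y - inner x (S' y) =
  inner (Gamma1 x) (Gamma0 y) - inner (Gamma0 x) (Gamma1 y).
Proof. by case: Gamma_triplet => _ _ + _; apply. Qed.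

Lemma Gamma_onto h k : exists f, [/\ dom S' f, Gamma0 f = h & Gamma1 f = k].
Proof. by case: Gamma_triplet. Qed.

Lemma Gamma0_linear : linear_on (dom S') Gamma0.
Proof. by case: Gamma_triplet. Qed.

Lemma Gamma1_linear : linear_on (dom S') Gamma1.
Proof. by case: Gamma_triplet. Qed.

Lemma Gamma_eq0 x : dom S' x ->
  (forall y, dom S' y -> inner (S' x) y = inner x (S' y)) ->
  Gamma0 x = 0 /\ Gamma1 x = 0.
Proof.
move=> dx hx; split; apply: inner_self_eq0.
  have [y [dy y0 y1]] := Gamma_onto 0 (Gamma0 x).
  have := green dx dy; rewrite hx // subrr y0 y1 inner0r sub0r => /esym/eqP.
  by rewrite oppr_eq0 => /eqP.
have [y [dy y0 y1]] := Gamma_onto (Gamma1 x) 0.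
by have := green dx dy; rewrite hx // subrr y0 y1 inner0r subr0.
Qed.

Lemma Gamma_dom x : dom S x -> Gamma0 x = 0 /\ Gamma1 x = 0.
Proof.
move=> dx; have [dx' ex] := adj_extends dx; apply: Gamma_eq0 => // y dy.
by rewrite ex; exact: adjointP.
Qed.

Lemma closed_graph_adherent u w : (forall e : R, 0 < e ->
    exists x, [/\ dom S x, rnorm (u - x) < e & rnorm (w - S x) < e]) ->
  dom S u /\ S u = w.
Proof.
move=> ap; have : closure [set p : H * H | dom S p.1 /\ p.2 = S p.1] (u, w).
  move=> U /nbhs_ballP [e /= e0 eU].
  have eR : e \is Num.real by rewrite gtr0_real.
  have e0' : 0 < complex.Re e by rewrite -ltcR RRe_real.
  have [x [dx ux wx]] := ap _ e0'.
  exists (x, S x); split=> //; apply: eU; split; rewrite /= -ball_normE /ball_ /=;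
    by rewrite rnormE -(RRe_real eR) ltcR.
by move/S_closed => /= [du ->].
Qed.

(* The range of [S - i] is closed with orthogonal complement [ker (S' + i)], so
   [x] differs from an element of [dom S] by some [y] in [ker (S' - i)] that
   also satisfies the boundary conditions, which forces [y = 0]. *)
Lemma dom_of_Gamma0 x : dom S' x -> Gamma0 x = 0 -> Gamma1 x = 0 ->
  dom S x /\ S x = S' x.
Proof.
move=> dx x0 x1.
have i1 : complex.Im ('i%C : R[i]) != 0 by rewrite /= oner_eq0.
have iJ : Num.conj ('i%C : R[i]) = - 'i%C by exact: conjCi.
have [|u [du hu]] := symmetric_range dom_linear_set dom_linear_on S_symmetric i1
  closed_graph_adherent (z := S' x - 'i%C *: x).
  move=> v hv; have [dv ev] : dom S' v /\ S' v = - 'i%C *: v.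
    apply: adjointI => // y dy; have /eqP := hv y dy.
    by rewrite innerBl innerZl subr_eq0 => /eqP ->; rewrite innerZr rmorphN /= iJ opprK.
  have := green dx dv; rewrite x0 x1 !inner0l subrr => /eqP; rewrite subr_eq0 => /eqP.
  by rewrite innerBl innerZl => ->; rewrite ev innerZr rmorphN /= iJ opprK subrr.
have [du' eu] := adj_extends du; have [u0 u1] := Gamma_dom du.
have dy : dom S' (x - u) by exact: (subspB adj_linear_set dx du').
have ey : S' (x - u) = 'i%C *: (x - u).
  rewrite (lin_onB adj_linear_set adj_linear) // eu scalerBr.
  by rewrite (sub_swap hu).
have := green dy dy; rewrite (lin_onB adj_linear_set Gamma0_linear) //.
rewrite (lin_onB adj_linear_set Gamma1_linear) //.
rewrite x0 x1 u0 u1 !subr0 !inner0l subrr ey innerZl innerZr iJ.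
rewrite mulNr opprK -mulrDl -mulr2n => /eqP; rewrite mulf_eq0 mulrn_eq0 /=.
case/orP=> [/eqP/(congr1 (@complex.Im R)) /= /eqP|/eqP/inner_self_eq0 /eqP].
  by rewrite oner_eq0.
by rewrite subr_eq0 => /eqP ->; split.
Qed.

(** This is the inclusion of the double adjoint in [S]. Testing with [dom S] puts [x] into [dom S'];
    testing with all of [dom S'] then annihilates both boundary values. *)
Lemma double_adjoint x w :
  (forall y, dom S' y -> inner x (S' y) = inner w y) -> dom S x /\ S x = w.
Proof.
move=> hx; have [dx ex] : dom S' x /\ S' x = w.
  apply: adjointI => // y dy; have [dy' <-] := adj_extends dy.
  by rewrite inner_conj hx // -inner_conj.
have [|x0 x1] := Gamma_eq0 dx; first by move=> y dy; rewrite ex hx.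
by have [? ->] := dom_of_Gamma0 dx x0 x1.
Qed.

(** * The self-adjoint extension of [S] with domain [ker Gamma0], its resolvent and the gamma
    field *)

Definition kerGamma0 : set H := [set x | dom S' x /\ Gamma0 x = 0].

Lemma kerGamma0_linear_set : linear_set kerGamma0.
Proof.
split=> [|a x y [dx x0] [dy y0]].
  by split; [exact: adj_linear_set.1 | exact: (lin_on0 adj_linear_set Gamma0_linear)].
split; first exact: adj_linear_set.2.
by rewrite Gamma0_linear // x0 y0 scaler0 addr0.
Qed.

Lemma kerGamma0_linear : linear_on kerGamma0 S'.
Proof. by move=> a x y [dx _] [dy _]; exact: adj_linear. Qed.

Lemma kerGamma0_symmetric x y : kerGamma0 x -> kerGamma0 y ->
  inner (S' x) y = inner x (S' y).
Proof.
move=> [dx x0] [dy y0]; apply/eqP; rewrite -subr_eq0 green // x0 y0.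
by rewrite inner0l inner0r subrr.
Qed.

Lemma kerGamma0_self_adjoint y : dom S' y ->
  (forall x, kerGamma0 x -> inner (S' x) y = inner x (S' y)) -> kerGamma0 y.
Proof.
move=> dy hy; split=> //; apply: inner_self_eq0.
have [x [dx x0 x1]] := Gamma_onto 0 (Gamma0 y).
by have := green dx dy; rewrite hy // subrr x0 x1 inner0l subr0.
Qed.

Lemma kerGamma0_closed u w : (forall e : R, 0 < e ->
    exists x, [/\ kerGamma0 x, rnorm (u - x) < e & rnorm (w - S' x) < e]) ->
  kerGamma0 u /\ S' u = w.
Proof.
move=> ap; have [du eu] : dom S' u /\ S' u = w.
  by apply: adj_closed => e e0; have [x [[dx _] ux wx]] := ap e e0; exists x.
split=> //; apply: kerGamma0_self_adjoint => // x kx; rewrite eu.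
apply: inner_approx => e e0; have [y [ky uy wy]] := ap e e0.
by exists y, (S' y); split=> //; exact: kerGamma0_symmetric.
Qed.

(** A vector orthogonal to the range lies in [kerGamma0] by self-adjointness and is an eigenvector
    for the non-real number conjugate to [mu], hence zero. *)
Lemma resolvent_exists mu z : complex.Im mu != 0 ->
  exists u, kerGamma0 u /\ S' u - mu *: u = z.
Proof.
move=> m0; apply: symmetric_range => //.
- exact: kerGamma0_linear_set.
- exact: kerGamma0_linear.
- exact: kerGamma0_symmetric.
- exact: kerGamma0_closed.
move=> v hv.
have adjv x : kerGamma0 x -> inner (S' x) v = inner x (Num.conj mu *: v).
  move=> kx; have /eqP := hv x kx.
  by rewrite innerBl innerZl subr_eq0 => /eqP ->; rewrite innerZr conjCK.
have [dv ev] : dom S' v /\ S' v = Num.conj mu *: v.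
  apply: adjointI => // y dy; have [dy' <-] := adj_extends dy.
  by apply: adjv; split=> //; have [] := Gamma_dom dy.
have kv : kerGamma0 v by apply: kerGamma0_self_adjoint => // x kx; rewrite ev adjv.
have m0' : complex.Im (Num.conj mu) != 0 by rewrite Im_conjC oppr_eq0.
have := symmetric_lower_bound (Num.conj mu) kerGamma0_symmetric kv.
rewrite ev subrr rnorm0 pmulr_rle0 ?normr_gt0 // => v0.
have -> : v = 0 by apply: rnorm_eq0; apply/eqP; rewrite eq_le v0 rnorm_ge0.
exact: inner0r.
Qed.

Lemma kerGamma0_eigen mu u : complex.Im mu != 0 -> kerGamma0 u ->
  S' u - mu *: u = 0 -> u = 0.
Proof.
move=> m0 ku hu; have := symmetric_lower_bound mu kerGamma0_symmetric ku.
rewrite hu rnorm0 pmulr_rle0 ?normr_gt0 // => u0.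
by apply: rnorm_eq0; apply/eqP; rewrite eq_le u0 rnorm_ge0.
Qed.

Definition resolvent mu z : H := xget 0 [set u | kerGamma0 u /\ S' u - mu *: u = z].

Lemma resolventP mu z : complex.Im mu != 0 ->
  kerGamma0 (resolvent mu z) /\ S' (resolvent mu z) - mu *: resolvent mu z = z.
Proof. by move=> m0; exact: xgetPex (resolvent_exists z m0). Qed.

Lemma shift_linear mu a x y : dom S' x -> dom S' y ->
  S' (a *: x + y) - mu *: (a *: x + y) = a *: (S' x - mu *: x) + (S' y - mu *: y).
Proof.
move=> dx dy; rewrite adj_linear // scalerBr scalerDr opprD addrACA.
by rewrite !scalerA mulrC.
Qed.

Lemma resolvent_eq mu z u : complex.Im mu != 0 -> kerGamma0 u ->
  S' u - mu *: u = z -> resolvent mu z = u.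
Proof.
move=> m0 ku hu; have [kr hr] := resolventP z m0.
apply/esym/eqP; rewrite -subr_eq0; apply/eqP; apply: (kerGamma0_eigen m0).
  exact: (subspB kerGamma0_linear_set ku kr).
have := shift_linear mu (-1) kr.1 ku.1.
by rewrite !scaleN1r !(addrC (- _)) hu hr subrr.
Qed.

Lemma resolvent_linear mu : complex.Im mu != 0 -> linear (resolvent mu).
Proof.
move=> m0 a x y; have [kx hx] := resolventP x m0; have [ky hy] := resolventP y m0.
apply: resolvent_eq => //; first exact: kerGamma0_linear_set.2.
by rewrite shift_linear ?hx ?hy //; [exact: kx.1 | exact: ky.1].
Qed.

Lemma resolvent_bound mu z : complex.Im mu != 0 ->
  rnorm (resolvent mu z) <= `|complex.Im mu|^-1 * rnorm z.
Proof.
move=> m0; have [kr hr] := resolventP z m0.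
rewrite mulrC ler_pdivlMr ?normr_gt0 // mulrC -{2}hr.
exact: (symmetric_lower_bound mu kerGamma0_symmetric kr).
Qed.

Lemma resolvent_adjoint mu x y : complex.Im mu != 0 ->
  inner (resolvent mu x) y = inner x (resolvent (Num.conj mu) y).
Proof.
move=> m0; have m0' : complex.Im (Num.conj mu) != 0 by rewrite Im_conjC oppr_eq0.
have [kx hx] := resolventP x m0; have [ky hy] := resolventP y m0'.
rewrite -{1}hy -{2}hx innerBl innerBr kerGamma0_symmetric //.
by rewrite innerZl innerZr conjCK.
Qed.

(** Any [f] with [Gamma0 f = h] is corrected by the [u] in [kerGamma0] having the same image under
    [S' - mu]. *)
Lemma gamma_exists mu h : complex.Im mu != 0 ->
  exists f, ker_sub S' mu f /\ Gamma0 f = h.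
Proof.
move=> m0; have [f [df f0 f1]] := Gamma_onto h 0.
have [u [[du u0] hu]] := resolvent_exists (S' f - mu *: f) m0.
exists (f - u); split; last by rewrite (lin_onB adj_linear_set Gamma0_linear) // u0 f0 subr0.
split; first exact: (subspB adj_linear_set df du).
rewrite (lin_onB adj_linear_set adj_linear) // scalerBr.
by have := sub_swap (esym hu); rewrite -opprB -[RHS]opprB => /oppr_inj.
Qed.

(** The inverse of [Gamma0] restricted to the defect subspace at [mu]; composed with [Gamma1] it is
    the Weyl function. The default [0] can matter only at real [mu]. *)
Definition gamma_field mu h : H := xget 0 [set f | ker_sub S' mu f /\ Gamma0 f = h].
Local Notation gam := gamma_field.

Lemma gammaP mu h : complex.Im mu != 0 ->
  [/\ dom S' (gam mu h), S' (gam mu h) = mu *: gam mu h & Gamma0 (gam mu h) = h].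
Proof.
by move=> m0; have [[]] : ker_sub S' mu (gam mu h) /\ Gamma0 (gam mu h) = h
  by exact: xgetPex (gamma_exists h m0).
Qed.

Lemma gamma_eq mu h f : complex.Im mu != 0 -> dom S' f -> S' f = mu *: f ->
  Gamma0 f = h -> gam mu h = f.
Proof.
move=> m0 df ef f0; have [dg eg g0] := gammaP h m0.
apply/eqP; rewrite -subr_eq0; apply/eqP; apply: (kerGamma0_eigen m0).
  split; first exact: (subspB adj_linear_set dg df).
  by rewrite (lin_onB adj_linear_set Gamma0_linear) // f0 g0 subrr.
by rewrite (lin_onB adj_linear_set adj_linear) // eg ef scalerBr subrr.
Qed.

Lemma gamma_linear mu : complex.Im mu != 0 -> linear (gam mu).
Proof.
move=> m0 a h k; have [dh eh h0] := gammaP h m0; have [dk ek k0] := gammaP k m0.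
apply: gamma_eq => //; first exact: adj_linear_set.2.
  by rewrite adj_linear // eh ek scalerDr !scalerA mulrC.
by rewrite Gamma0_linear // h0 k0.
Qed.

(** The familiar identity expressing [gam mu] as [I + (mu - lam) R(mu)] applied to [gam lam]: the
    difference of the two values has vanishing [Gamma0]. *)
Lemma resolvent_gamma mu lam h : complex.Im mu != 0 -> complex.Im lam != 0 ->
  mu != lam -> resolvent mu (gam lam h) = (mu - lam)^-1 *: (gam mu h - gam lam h).
Proof.
move=> m0 l0 ml; have [dm em hm] := gammaP h m0; have [dl el hl] := gammaP h l0.
have dml : dom S' (gam mu h - gam lam h) by exact: (subspB adj_linear_set dm dl).
apply: resolvent_eq => //.
  split; first exact: (subspZ adj_linear_set _ dml).
  rewrite (lin_onZ adj_linear_set Gamma0_linear) // (lin_onB adj_linear_set Gamma0_linear) //.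
  by rewrite hm hl subrr scaler0.
rewrite (lin_onZ adj_linear_set adj_linear) // (lin_onB adj_linear_set adj_linear) // em el.
rewrite [mu *: (_ *: _)]scalerA [mu * _]mulrC -scalerA -scalerBr [mu *: (_ - _)]scalerBr opprB.
rewrite [X in _ *: X]addrC addrA subrK -scalerBl scalerA mulVf ?scale1r //.
by rewrite subr_eq0.
Qed.

Lemma gamma_shift mu (r : R) h : complex.Im mu != 0 ->
  rnorm (gam (mu + r%:C%C) h - gam mu h) <=
  `|r| * (`|complex.Im mu|^-1 * rnorm (gam mu h)).
Proof.
move=> m0; set lam := mu + r%:C%C.
have il : complex.Im lam = complex.Im mu by rewrite ImD addr0.
have l0 : complex.Im lam != 0 by rewrite il.
have [r00|r0] := eqVneq r 0.
  have -> : lam = mu by rewrite /lam r00 -[RHS]addr0.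
  by rewrite subrr rnorm0 r00 normr0 mul0r.
have dlm : lam - mu = r%:C%C by rewrite /lam addrC addKr.
have rC : (r%:C%C : R[i]) != 0 by rewrite eq_complex /= negb_and r0.
have lm : lam != mu by rewrite -subr_eq0 dlm.
have -> : gam lam h - gam mu h = r%:C%C *: resolvent lam (gam mu h).
  by rewrite resolvent_gamma // dlm scalerA divff // scale1r.
rewrite rnormZ rnormR ler_wpM2l // -il; exact: (resolvent_bound _ l0).
Qed.

Lemma gamma_green mu lam h k : complex.Im mu != 0 -> complex.Im lam != 0 ->
  (mu - Num.conj lam) * inner (gam mu h) (gam lam k) =
  inner (Gamma1 (gam mu h)) k - inner h (Gamma1 (gam lam k)).
Proof.
move=> m0 l0; have [dm em hm] := gammaP h m0; have [dl el hl] := gammaP k l0.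
by have := green dm dl; rewrite em el hm hl innerZl innerZr -mulrBl.
Qed.

(* Testing against [y] in [ker Gamma0] with [Gamma1 y = h] shows that the [k] with
   [|gam mu k| <= 1] form a weakly bounded set. *)
Lemma gamma_lower_bound mu : complex.Im mu != 0 ->
  exists c : R, 0 <= c /\ forall k, rnorm k <= c * rnorm (gam mu k).
Proof.
move=> m0.
have [c hc] : exists c : R, forall k, [set k | rnorm (gam mu k) <= 1] k -> rnorm k <= c.
  apply: weakly_bounded => h; have [y [dy y0 y1]] := Gamma_onto 0 h.
  exists (rnorm (S' y - Num.conj mu *: y)) => k /= k1.
  have [dk ek k0] := gammaP k m0.
  have := green dk dy; rewrite ek k0 y0 y1 inner0r sub0r => e.
  have -> : inner h k = Num.conj (inner (gam mu k) (S' y - Num.conj mu *: y)).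
    rewrite innerBr innerZr conjCK -[inner h k]conjCK -inner_conj.
    by congr Num.conj; rewrite -[LHS]opprK -e innerZl opprB.
  rewrite rnormJ; apply: le_trans (cauchy_schwarz _ _) _.
  by rewrite ler_piMl // rnorm_ge0.
have lg := gamma_linear m0.
have c0 : 0 <= c.
  by apply: le_trans (hc 0 _); rewrite ?rnorm_ge0 //= (lin0 lg) rnorm0.
exists c; split=> // k; have [/rnorm_eq0 g0|g0] := eqVneq (rnorm (gam mu k)) 0.
  have [_ _ kE] := gammaP k m0.
  have -> : k = 0 by rewrite -kE g0 (lin_on0 adj_linear_set Gamma0_linear).
  by rewrite rnorm0 mulr_ge0 ?rnorm_ge0.
have gp : 0 < rnorm (gam mu k) by rewrite lt_def g0 rnorm_ge0.
have gi : 0 <= (rnorm (gam mu k))^-1 by rewrite invr_ge0 ltW.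
have /hc : [set k | rnorm (gam mu k) <= 1] ((rnorm (gam mu k))^-1%:C%C *: k).
  by rewrite /= (linZ lg) rnormZ rnormR ger0_norm // mulVf.
by rewrite rnormZ rnormR ger0_norm // mulrC ler_pdivrMr.
Qed.

Lemma adj_commutes (X X' : H -> H) :
  (forall x y, inner (X x) y = inner x (X' y)) ->
  (forall x, dom S x -> dom S (X' x) /\ S (X' x) = X' (S x)) ->
  forall y, dom S' y -> dom S' (X y) /\ S' (X y) = X (S' y).
Proof.
move=> adjX cX y dy; apply: adjointI => // x dx.
have adjX' u v : inner u (X v) = inner (X' u) v.
  by rewrite inner_conj adjX -inner_conj.
by have [dx' ex] := cX x dx; rewrite !adjX' -ex (adjointP dy).
Qed.

(** Green's formula has the same left side at [(X f, g)] and at [(f, X' g)]. Choosing [f] with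
    [Gamma0 f = 0] and [g] with [Gamma1 g = 0] leaves one term on each right side. *)
Lemma boundary_adjoint (X X' : H -> H) (T T' : G -> G) :
  (forall x y, inner (X x) y = inner x (X' y)) ->
  (forall y, dom S' y -> dom S' (X y) /\ S' (X y) = X (S' y)) ->
  (forall y, dom S' y -> dom S' (X' y) /\ S' (X' y) = X' (S' y)) ->
  (forall f, dom S' f -> T (Gamma1 f) = Gamma1 (X f)) ->
  (forall f, dom S' f -> T' (Gamma0 f) = Gamma0 (X' f)) ->
  forall h k, inner (T h) k = inner h (T' k).
Proof.
move=> adjX cX cX' T1 T0 h k.
have [f [df f0 f1]] := Gamma_onto 0 h; have [g [dg g0 g1]] := Gamma_onto k 0.
have [dXf eXf] := cX f df; have [dXg eXg] := cX' g dg.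
have := green dXf dg; have := green df dXg.
rewrite eXf eXg g0 g1 f0 -T1 // -T0 // f1 g0 inner0l inner0r !subr0 !adjX.
by move=> -> <-.
Qed.

Lemma gamma_commutes (X : H -> H) (T : G -> G) mu h : complex.Im mu != 0 -> linear X ->
  (forall y, dom S' y -> dom S' (X y) /\ S' (X y) = X (S' y)) ->
  (forall f, dom S' f -> T (Gamma0 f) = Gamma0 (X f)) ->
  X (gam mu h) = gam mu (T h).
Proof.
move=> m0 lX cX T0; have [dg eg g0] := gammaP h m0; have [dX eX] := cX _ dg.
by apply/esym/gamma_eq => //; rewrite ?eX ?eg ?(linZ lX) // -T0 // g0.
Qed.

(** * C-symmetries of [S] and their images in [G] *)

Variables (J : H -> H) (calJ : G -> G).
Hypothesis J_symmetry : fundamental_symmetry J.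
Hypothesis SJ : commutes S J.
Hypothesis calJ0 : forall f, dom S' f -> calJ (Gamma0 f) = Gamma0 (J f).
Hypothesis calJ1 : forall f, dom S' f -> calJ (Gamma1 f) = Gamma1 (J f).

Lemma symmetry_sym x y : inner (J x) y = inner x (J y).
Proof. by case: J_symmetry => _ /self_adjoint_everywhere. Qed.

Lemma symmetry_inv : J \o J =1 id.
Proof. by case: J_symmetry. Qed.

Lemma adj_symmetry y : dom S' y -> dom S' (J y) /\ S' (J y) = J (S' y).
Proof. by apply: adj_commutes symmetry_sym _ _ => x; exact: commutes_dom. Qed.

Lemma calJ_sym h k : inner (calJ h) k = inner h (calJ k).
Proof. exact: (boundary_adjoint symmetry_sym adj_symmetry adj_symmetry calJ1 calJ0). Qed.

Lemma calJ_inv : calJ \o calJ =1 id.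
Proof.
move=> h; have [f [df <- _]] := Gamma_onto h 0; have [dJ _] := adj_symmetry df.
by rewrite /= !calJ0 // [J (J f)]symmetry_inv.
Qed.

Section CSymmetry.
Variables (X : H -> H) (T : G -> G).
Hypothesis X_C : C_operator J X.
Hypothesis SX : commutes S X.
Hypothesis T0 : forall f, dom S' f -> T (Gamma0 f) = Gamma0 (X f).
Hypothesis T1 : forall f, dom S' f -> T (Gamma1 f) = Gamma1 (X f).

Lemma C_symmetry_adjoint x y : inner (X x) y = inner x (J (X (J y))).
Proof. by case: X_C => _ _ JX; exact: (C_adjoint symmetry_sym symmetry_inv JX). Qed.

Lemma C_symmetry_linear : linear X.
Proof. exact: (adjoint_pair_linear C_symmetry_adjoint). Qed.

Lemma C_symmetry_inv : X \o X =1 id.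
Proof. by case: X_C. Qed.

Lemma adj_C_symmetry y : dom S' y -> dom S' (X y) /\ S' (X y) = X (S' y).
Proof.
apply: adj_commutes C_symmetry_adjoint _ _ => x dx.
have [d1 e1] := commutes_dom SJ dx; have [d2 e2] := commutes_dom SX d1.
by have [d3 e3] := commutes_dom SJ d2; rewrite e3 e2 e1.
Qed.

Lemma adj_C_symmetry_adjoint y : dom S' y ->
  dom S' (J (X (J y))) /\ S' (J (X (J y))) = J (X (J (S' y))).
Proof.
move=> dy; have [d1 e1] := adj_symmetry dy; have [d2 e2] := adj_C_symmetry d1.
by have [d3 e3] := adj_symmetry d2; rewrite e3 e2 e1.
Qed.

Lemma image_adjoint h k : inner (T h) k = inner h (calJ (T (calJ k))).
Proof.
apply: (boundary_adjoint C_symmetry_adjoint adj_C_symmetry adj_C_symmetry_adjoint T1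
  (T' := fun k => calJ (T (calJ k)))) => f df.
have [d1 _] := adj_symmetry df; have [d2 _] := adj_C_symmetry d1.
by rewrite calJ0 // T0 // calJ0.
Qed.

Lemma image_inv : T \o T =1 id.
Proof.
move=> h; have [f [df <- _]] := Gamma_onto h 0; have [dX _] := adj_C_symmetry df.
by rewrite /= !T0 // [X (X f)]C_symmetry_inv.
Qed.

(* On [gam i], the map [calJ T] corresponds to the positive operator [J X], so
   the powers of [t - calJ T] grow at most like [t ^+ n] for the norm pulled back
   by [gam i], hence for the norm of [G]. *)
Lemma image_positive : positive_operator (calJ \o T).
Proof.
have symT h k : inner (calJ (T h)) k = inner h (calJ (T k)).
  by rewrite calJ_sym image_adjoint [calJ (calJ k)]calJ_inv.
have lT := adjoint_pair_linear symT.
have [bX XX JX] := X_C; have [symX posX] := positive_operatorE JX.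
have [t [t0 bJX]] : exists c : R, 0 <= c /\ forall x, rnorm (J (X x)) <= c * rnorm x.
  exact: (hellinger_toeplitz symX).
have hB := complement_bound symX t0 posX bJX.
have i0 : complex.Im ('i%C : R[i]) != 0 by rewrite /= oner_eq0.
have lg := gamma_linear i0.
have gT h : J (X (gam 'i%C h)) = gam 'i%C (calJ (T h)).
  rewrite (gamma_commutes h i0 C_symmetry_linear adj_C_symmetry T0).
  by rewrite (gamma_commutes _ i0 (adjoint_pair_linear symmetry_sym) adj_symmetry calJ0).
have [c [c0 hc]] := gamma_lower_bound i0.
pose B h := t%:C%C *: h - calJ (T h).
have gB h n : rnorm (gam 'i%C (iter n B h)) <= t ^+ n * rnorm (gam 'i%C h).
  elim: n => [|n IH]; first by rewrite mul1r.
  have -> : gam 'i%C (iter n.+1 B h) =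
      t%:C%C *: gam 'i%C (iter n B h) - J (X (gam 'i%C (iter n B h))).
    by rewrite gT -(linZ lg) -(linB lg).
  by apply: le_trans (hB _) _; rewrite exprS -mulrA ler_wpM2l.
apply: positive_operatorI => [//|h k /= hk|].
  have : T (calJ (calJ (T h))) = T (calJ (calJ (T k))) by rewrite hk.
  by rewrite ![calJ (calJ _)]calJ_inv ![T (T _)]image_inv.
apply: (positive_of_complement (t := t)) => h.
apply: (symmetric_orbit_bound (x := fun n => iter n B h) (c := c * rnorm (gam 'i%C h)) t0).
  move=> m n /=; rewrite /B innerBl innerBr innerZl innerZr symT.
  by rewrite (_ : Num.conj (t%:C%C : R[i]) = t%:C%C) //; exact: conjc_real.
move=> n; apply: le_trans (hc _) _; rewrite -mulrA ler_wpM2l //.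
by rewrite [leRHS]mulrC.
Qed.

Lemma image_C_operator : C_operator calJ T.
Proof.
split; [|exact: image_inv|exact: image_positive].
apply/bounded_operatorP; split; first exact: (adjoint_pair_linear image_adjoint).
exact: (hellinger_toeplitz image_adjoint).
Qed.

Lemma weyl_commutes mu h : complex.Im mu != 0 ->
  Gamma1 (gam mu (T h)) = T (Gamma1 (gam mu h)).
Proof.
move=> m0; have [dg _ _] := gammaP h m0.
by rewrite -(gamma_commutes h m0 C_symmetry_linear adj_C_symmetry T0) T1.
Qed.

End CSymmetry.

(** * Extensions in terms of the boundary maps [Omega_plus] and [Omega_minus] *)

Local Notation Op := (Omega_plus Gamma0 Gamma1).
Local Notation Om := (Omega_minus Gamma0 Gamma1).

Lemma sqrt2V_neq0 : (sqrtC 2 : R[i])^-1 != 0.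
Proof. by rewrite invr_eq0 sqrtC_eq0 pnatr_eq0. Qed.

Lemma sqrt2V_conj : (sqrtC 2 : R[i])^-1 * Num.conj (sqrtC 2 : R[i])^-1 = 2^-1.
Proof.
have r2 : (sqrtC 2 : R[i]) \is Num.real by rewrite ger0_real // sqrtC_ge0 ler0n.
by rewrite fmorphV /= conj_Creal // -invfM -expr2 sqrtCK.
Qed.

Lemma Omega_onto h k : exists f, [/\ dom S' f, Op f = h & Om f = k].
Proof.
set s : R[i] := (sqrtC 2)^-1; have s0 : s != 0 := sqrt2V_neq0.
have i0 : ('i : R[i]) != 0 by exact: neq0Ci.
have n2 : (2 : R[i]) != 0 by rewrite pnatr_eq0.
have [f [df f0 f1]] := Gamma_onto ((s * 2 * 'i)^-1 *: (h - k)) ((s * 2)^-1 *: (h + k)).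
exists f; rewrite /Omega_plus /Omega_minus f0 f1 -/s; split=> //.
  rewrite scalerA (_ : 'i / (s * 2 * 'i) = (s * 2)^-1); last by field; rewrite s0.
  rewrite -scalerDr scalerA (_ : s / (s * 2) = 2^-1); last by field; rewrite s0.
  by rewrite addrACA subrr addr0 -[h + h]mulr2n -[h *+ 2]scaler_nat scalerA mulVf // scale1r.
rewrite scalerA (_ : 'i / (s * 2 * 'i) = (s * 2)^-1); last by field; rewrite s0.
rewrite -scalerBr scalerA (_ : s / (s * 2) = 2^-1); last by field; rewrite s0.
rewrite opprB [h + k]addrC addrACA subrr addr0.
by rewrite -[k + k]mulr2n -[k *+ 2]scaler_nat scalerA mulVf // scale1r.
Qed.

(** Passing from [Gamma] to [Omega] diagonalizes Green's form, so that J-self-adjointness becomes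
    neutrality for the difference of two [calJ] metrics. *)
Lemma Omega_green x y : dom S' x -> dom S' y ->
  inner (S' x) (J y) - inner x (S' (J y)) =
  'i * (inner (Op x) (calJ (Op y)) - inner (Om x) (calJ (Om y))).
Proof.
move=> dx dy; have [dJ _] := adj_symmetry dy; rewrite green // -calJ0 // -calJ1 //.
have lJ := adjoint_pair_linear calJ_sym.
rewrite /Omega_plus /Omega_minus !(linZ lJ) !(linD lJ) !(linN lJ) !(linZ lJ).
rewrite !innerZl !innerZr !mulrA sqrt2V_conj.
rewrite !(innerDl, innerDr, innerNl, innerNr) !innerZl !innerZr conjCi.
have i2 : ('i : R[i]) * 'i = -1 by rewrite -expr2 sqrCi.
rewrite [RHS](_ : _ = - ('i * 'i) *
  (inner (Gamma1 x) (calJ (Gamma0 y)) - inner (Gamma0 x) (calJ (Gamma1 y)))).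
  by rewrite i2 opprK mul1r.
by field.
Qed.

Lemma Omega_commutes (X : H -> H) (T : G -> G) f : linear T ->
  T (Gamma0 f) = Gamma0 (X f) -> T (Gamma1 f) = Gamma1 (X f) ->
  T (Op f) = Op (X f) /\ T (Om f) = Om (X f).
Proof.
move=> lT t0 t1; rewrite /Omega_plus /Omega_minus.
by rewrite !(linZ lT) (linD lT) (linB lT) !(linZ lT) t0 t1.
Qed.

Lemma J_self_adjointP (A : operator H) : J_self_adjoint J A <->
  densely_defined A /\ (forall y, dom A y <-> dom (adjoint A) (J y)) /\
  forall y, dom A y -> adjoint A (J y) = J (A y).
Proof.
split=> [[dA [[sJA _] [sAJ eAJ]]]|[dA [sJA eJA]]]; split=> //.
  split=> [y|y dy]; last exact: (eAJ y (conj dy I)).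
  split=> dy; first by have [] := sAJ y (conj dy I).
  by have [] := sJA y (conj I dy).
split; split=> y dy.
- by split=> //; apply/sJA; case: dy.
- by apply/esym/eJA/sJA; case: dy.
- by split=> //; apply/sJA; case: dy.
- by apply/eJA; case: dy.
Qed.

(** As [A] extends [S], its adjoint is contained in [S']; conjugating by [J], which commutes with
    [S'], gives the same for [A]. *)
Lemma Sigma_J_adj (A : operator H) x : Sigma_J J S A -> dom A x ->
  dom S' x /\ S' x = A x.
Proof.
move=> [_ /J_self_adjointP [_ [sAJ eAJ]] [sSA eSA]] dx.
have dJx := (sAJ x).1 dx; have eJx := eAJ x dx.
have [dJ eJ] : dom S' (J x) /\ S' (J x) = J (A x).
  apply: adjointI => // y dy; rewrite -eSA // -eJx; by apply: (adjointP dJx); exact: sSA.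
have [+ +] := adj_symmetry dJ; rewrite [J (J x)]symmetry_inv eJ [J (J (A x))]symmetry_inv.
by [].
Qed.

(** In one direction this is the symmetry of [J A]. In the other, neutrality against all of [dom A]
    puts [J y] into the domain of the adjoint, hence [y] into [dom A]. *)
Lemma Sigma_J_maximal (A : operator H) y : Sigma_J J S A ->
  dom A y <-> dom S' y /\
    forall x, dom A x -> inner (Op x) (calJ (Op y)) = inner (Om x) (calJ (Om y)).
Proof.
move=> AS; have [_ /J_self_adjointP [dA [sAJ eAJ]] _] := AS.
have i0 : ('i : R[i]) != 0 by exact: neq0Ci.
split=> [dy|[dy hy]].
  have [dy' ey] := Sigma_J_adj AS dy; split=> // x dx; have [dx' ex] := Sigma_J_adj AS dx.
  apply/eqP; rewrite -subr_eq0 -(mulrI_eq0 _ (mulfI i0)) -Omega_green // ex.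
  have dJy := (sAJ y).1 dy; have eJy := eAJ y dy.
  by rewrite (adjointP dJy) // eJy -ey; have [_ ->] := adj_symmetry dy'; rewrite subrr.
have [dJ eJ] := adj_symmetry dy.
have [dJy _] : dom (adjoint A) (J y) /\ adjoint A (J y) = S' (J y).
  apply: adjointI => // x dx; have [dx' ex] := Sigma_J_adj AS dx.
  by apply/eqP; rewrite -subr_eq0 -ex Omega_green // hy // subrr mulr0.
by apply/sAJ.
Qed.

Lemma stable_extension_J_unitary (A : operator H) (X : H -> H) (T : G -> G) :
  Sigma_J J S A -> commutes A X -> C_operator calJ T ->
  (forall f, dom S' f -> T (Gamma0 f) = Gamma0 (X f)) ->
  (forall f, dom S' f -> T (Gamma1 f) = Gamma1 (X f)) ->
  exists K, [/\ J_unitary calJ K, opeq A (oprestr S' [set f | K (Op f) = Om f])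
    & commutes (everywhere K) T].
Proof.
move=> AS AX TC T0 T1; have lT := (bounded_operatorP T).1 (let: And3 b _ _ := TC in b).
pose L p q := exists x, [/\ dom A x, Op x = p & Om x = q].
have L_max p q : L p q <-> forall a b, L a b -> inner a (calJ p) = inner b (calJ q).
  split=> [[y [dy <- <-]] _ _ [x [dx <- <-]]|h].
    by have [_] := (Sigma_J_maximal y AS).1 dy; apply.
  have [y [dy yp yq]] := Omega_onto p q; exists y; split=> //.
  apply/(Sigma_J_maximal y AS); split=> // x dx; rewrite yp yq; apply: h.
  by exists x.
have L_T p q : L p q -> L (T p) (T q).
  move=> [x [dx <- <-]]; have [dXx _] := commutes_dom AX dx.
  have [dx' _] := Sigma_J_adj AS dx.
  by have [-> ->] := Omega_commutes lT.1 (T0 _ dx') (T1 _ dx'); exists (X x).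
have [K [KJ LK KT]] := maximal_neutral_J_unitary calJ_sym calJ_inv L_max L_T TC.
exists K; split=> //; last exact/commutes_everywhere.
split; split=> x.
- move=> dx; have [dx' _] := Sigma_J_adj AS dx; split=> //.
  by apply/LK; exists x.
- by move=> dx; have [_ ->] := Sigma_J_adj AS dx.
(* [x] and [y] share their boundary values, and by [Sigma_J_maximal] membership in [dom A] depends
   on nothing else. *)
- move=> [dx /LK [y [dy yp yq]]]; have [dy' _] := Sigma_J_adj AS dy.
  apply/(Sigma_J_maximal x AS); split=> // z dz.
  by rewrite -yp -yq; have [_] := (Sigma_J_maximal y AS).1 dy; apply.
- move=> [dx /LK [y [dy yp yq]]].
  suff dAx : dom A x by have [_ ->] := Sigma_J_adj AS dAx.
  apply/(Sigma_J_maximal x AS); split=> // z dz.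
  by rewrite -yp -yq; have [_] := (Sigma_J_maximal y AS).1 dy; apply.
Qed.

Lemma J_unitary_extension (A : operator H) (K : G -> G) : J_unitary calJ K ->
  opeq A (oprestr S' [set f | K (Op f) = Om f]) -> Sigma_J J S A.
Proof.
move=> /(J_unitary_adjoint calJ_inv) [[lK _] [M [bM KM MK]] adjK] [[sA eA] [sA' eA']].
have domA x : dom A x <-> dom S' x /\ K (Op x) = Om x.
  by split=> [/sA []|[dx hx]] //; apply: sA'.
have valA x : dom A x -> A x = S' x by move=> dx; rewrite -(eA x dx).
have Olin a x y : dom S' x -> dom S' y ->
    Op (a *: x + y) = a *: Op x + Op y /\ Om (a *: x + y) = a *: Om x + Om y.
  move=> dx dy; rewrite /Omega_plus /Omega_minus Gamma0_linear // Gamma1_linear //.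
  split; rewrite scalerA mulrC -scalerA -scalerDr; congr (_ *: _).
    by rewrite !scalerDr !scalerA [_ * a]mulrC addrACA.
  by rewrite !scalerDr scalerN !scalerA [_ * a]mulrC opprD addrACA.
have SA : opsub S A.
  split=> x dx; have [dx' ex] := adj_extends dx; have [x0 x1] := Gamma_dom dx.
    apply/domA; split=> //; rewrite /Omega_plus /Omega_minus x0 x1 !scaler0.
    by rewrite addr0 subr0 !scaler0 (lin0 lK).
  have dA : dom A x; last by rewrite valA.
  apply/domA; split=> //; rewrite /Omega_plus /Omega_minus x0 x1 !scaler0.
  by rewrite addr0 subr0 !scaler0 (lin0 lK).
have dA : densely_defined A.
  move=> U U0 oU; have [x [Ux dx]] := S_dense U0 oU; exists x; split=> //; exact: SA.1.
have linA a x y : dom A x -> dom A y -> dom A (a *: x + y).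
  move=> /domA [dx hx] /domA [dy hy]; apply/domA; split; first exact: adj_linear_set.2.
  by have [-> ->] := Olin a x y dx dy; rewrite lK hx hy.
split=> //.
  split=> //; first by apply: SA.1; exact: dom_linear_set.1.
  move=> a x y dx dy; have [dx' _] := (domA x).1 dx; have [dy' _] := (domA y).1 dy.
  by rewrite !valA //; [exact: adj_linear | exact: linA].
have i0 : ('i : R[i]) != 0 by exact: neq0Ci.
have adjA y : dom A y -> dom (adjoint A) (J y) /\ adjoint A (J y) = J (A y).
  move=> dy; have [dy' hy] := (domA y).1 dy; have [dJ eJ] := adj_symmetry dy'.
  apply: adjointI => // x dx; have [dx' hx] := (domA x).1 dx.
  rewrite !valA // -eJ; apply/eqP; rewrite -subr_eq0 Omega_green // -hx -hy.
  by rewrite adjK subrr mulr0.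
apply/J_self_adjointP; split=> //; split=> y; last by move=> dy; have [] := adjA y dy.
split=> [dy|dJy]; first by have [] := adjA y dy.
have [dJ eJ] : dom S' (J y) /\ S' (J y) = adjoint A (J y).
  by apply: adjointI => // x dx; rewrite -SA.2 // (adjointP dJy) //; exact: SA.1.
have [dy ey] := adj_symmetry dJ; rewrite [J (J y)]symmetry_inv in dy.
apply/domA; split=> //.
(* Every [h] is [Op x] for some [x] in [dom A] with [Om x = K h]; testing [J y] against all these
   [x] determines [M (Om y)]. *)
suff : M (Om y) = Op y by move=> <-; rewrite MK.
suff JM : calJ (M (Om y)) = calJ (Op y).
  by rewrite -[LHS]calJ_inv -[RHS]calJ_inv /= JM.
apply: inner_ext => h; have [x [dx xp xm]] := Omega_onto h (K h).
have dAx : dom A x by apply/domA; split=> //; rewrite xp xm.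
rewrite -adjK MK -xm -xp.
apply/eqP; rewrite eq_sym -subr_eq0 -(mulrI_eq0 _ (mulfI i0)) -Omega_green // eJ.
by rewrite -valA // (adjointP dJy) // subrr.
Qed.

(** [lam] is a small real shift of [mu], hence non-real and distinct from it. Two vectors are
    approximated at once because [gamma_lift_sym] takes a limit on both sides. *)
Lemma gamma_approx mu h k (e : R) : complex.Im mu != 0 -> 0 < e -> exists lam,
  [/\ complex.Im lam != 0, lam != mu, rnorm (gam mu h - gam lam h) < e
    & rnorm (gam mu k - gam lam k) < e].
Proof.
move=> m0 e0; set c := `|complex.Im mu|^-1.
have c0 : 0 <= c by rewrite invr_ge0.
set d := c * rnorm (gam mu h) + c * rnorm (gam mu k) + 1.
have [nh nk] : 0 <= c * rnorm (gam mu h) /\ 0 <= c * rnorm (gam mu k).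
  by split; rewrite mulr_ge0 ?rnorm_ge0.
have d0 : 0 < d by rewrite /d; lra.
have r0 : 0 < e / d by rewrite divr_gt0.
have est (x : G) : c * rnorm (gam mu x) < d ->
    rnorm (gam mu x - gam (mu + (e / d)%:C%C) x) < e.
  move=> hx; rewrite rnormB; apply: le_lt_trans (gamma_shift _ _ m0) _.
  by rewrite gtr0_norm // mulrAC ltr_pdivrMr // ltr_pM2l.
exists (mu + (e / d)%:C%C); split.
- by rewrite ImD addr0.
- by rewrite -subr_eq0 addrC addKr eq_complex /= negb_and gt_eqF.
- by apply: est; rewrite /d; lra.
- by apply: est; rewrite /d; lra.
Qed.

(** Green's formula gives the usual expression for the adjoint of the gamma field; the mere
    existence of an adjoint makes [gam mu] bounded. *)
Lemma gamma_adjoint mu h f : complex.Im mu != 0 ->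
  inner (gam mu h) f = inner h (Gamma1 (resolvent (Num.conj mu) f)).
Proof.
move=> m0; have m0' : complex.Im (Num.conj mu) != 0 by rewrite Im_conjC oppr_eq0.
have [dg eg g0] := gammaP h m0; have [[dr r0] hr] := resolventP f m0'.
have := green dg dr; rewrite eg g0 r0 inner0r sub0r innerZl => e.
by rewrite -{1}hr innerBr innerZr conjCK -opprB e opprK.
Qed.

Lemma gamma_bound mu : complex.Im mu != 0 ->
  exists c : R, 0 <= c /\ forall h, rnorm (gam mu h) <= c * rnorm h.
Proof. by move=> m0; apply: (hellinger_toeplitz (fun h f => gamma_adjoint h f m0)). Qed.

(** ** Lifting an operator that commutes with the Weyl function *)

Section Lifting.
Variables (B : G -> G) (t : R).
Hypothesis B_sym : forall h k, inner (B h) k = inner h (B k).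
Hypothesis t_ge1 : 1 <= t.
Hypothesis B_bound : forall h, rnorm (B h) <= t * rnorm h.
Hypothesis B_weyl : forall mu h, complex.Im mu != 0 ->
  Gamma1 (gam mu (B h)) = B (Gamma1 (gam mu h)).

Let t_ge0 : 0 <= t. Proof. by apply: le_trans t_ge1. Qed.

(** Since [B] is symmetric and commutes with the Weyl function, [gamma_green] gives equality after
    multiplication by [mu] minus the conjugate of [lam]. Where this factor vanishes, the identity is
    a limit of its neighbours. *)
Lemma gamma_lift_sym mu lam h k : complex.Im mu != 0 -> complex.Im lam != 0 ->
  inner (gam mu (B h)) (gam lam k) = inner (gam mu h) (gam lam (B k)).
Proof.
move=> m0 l0.
have off_diagonal nu : complex.Im nu != 0 -> nu != Num.conj lam ->
    inner (gam nu (B h)) (gam lam k) = inner (gam nu h) (gam lam (B k)).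
  move=> n0 nl; have nl0 : nu - Num.conj lam != 0 by rewrite subr_eq0.
  apply: (mulfI nl0); rewrite !gamma_green //.
  by rewrite !B_weyl // !B_sym.
have [ml|] := eqVneq mu (Num.conj lam); last exact: off_diagonal.
rewrite inner_conj [RHS]inner_conj; congr Num.conj.
apply: inner_approx => e e0; have [nu [n0 nm h1 h2]] := gamma_approx (B h) h m0 e0.
exists (gam nu (B h)), (gam nu h); split=> //.
by rewrite inner_conj [RHS]inner_conj off_diagonal // -ml.
Qed.

(* The sequences of iterates on the span of the defect subspaces of the lift of
   [B], which is not yet known to be well defined there. *)
Inductive gamma_orbit : (nat -> H) -> Prop :=
| gamma_orbit_gen mu h : complex.Im mu != 0 ->
    gamma_orbit (fun n => gam mu (iter n B h))
| gamma_orbit_lin a (u v : nat -> H) : gamma_orbit u -> gamma_orbit v ->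
    gamma_orbit (fun n => a *: u n + v n).

Lemma gamma_orbit_shift (u : nat -> H) : gamma_orbit u ->
  exists2 v, gamma_orbit v & forall n, v n = u n.+1.
Proof.
elim=> [mu h m0|a u1 u2 _ [v1 o1 e1] _ [v2 o2 e2]].
  by exists (fun n => gam mu (iter n B (B h))) => [|n]; [exact: gamma_orbit_gen | rewrite -iterSr].
exists (fun n => a *: v1 n + v2 n); first exact: gamma_orbit_lin.
by move=> n; rewrite e1 e2.
Qed.

Lemma gamma_orbit_sym (u v : nat -> H) : gamma_orbit u -> gamma_orbit v ->
  forall m n, inner (u m.+1) (v n) = inner (u m) (v n.+1).
Proof.
move=> ou; elim: ou v => [mu h m0|a u1 u2 _ IH1 _ IH2] v ov m n; last first.
  by rewrite !innerDZl IH1 // IH2.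
elim: ov n => [lam k l0|a v1 v2 _ IH1 _ IH2] n; last by rewrite !innerDr !innerZr IH1 IH2.
exact: gamma_lift_sym.
Qed.

(** The constant depends on the orbit through the points [mu] it involves; only the rate [t ^+ n] is
    common, and [symmetric_orbit_bound] asks for no more. *)
Lemma gamma_orbit_growth (u : nat -> H) : gamma_orbit u ->
  exists c : R, forall n, rnorm (u n) <= c * t ^+ n.
Proof.
elim=> [mu h m0|a u1 u2 _ [c1 h1] _ [c2 h2]].
  have [c [c0 hc]] := gamma_bound m0; exists (c * rnorm h) => n.
  apply: le_trans (hc _) _; rewrite -mulrA ler_wpM2l //.
  elim: n => [|n IH]; first by rewrite mulr1.
  by apply: le_trans (B_bound _) _; rewrite exprS mulrCA ler_wpM2l.
exists (rnorm a * c1 + c2) => n; rewrite mulrDl -mulrA.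
apply: le_trans (rnormD _ _) _; rewrite rnormZ; apply: lerD => //.
by rewrite ler_wpM2l ?rnorm_ge0.
Qed.

Lemma gamma_orbit_bound (u : nat -> H) : gamma_orbit u -> rnorm (u 1%N) <= t * rnorm (u 0%N).
Proof.
move=> ou; have [c hc] := gamma_orbit_growth ou.
exact: (symmetric_orbit_bound t_ge0 (gamma_orbit_sym ou ou) hc).
Qed.

(** The orthogonal complement of the span of the defect subspaces, since [v 0] runs over that
    span. *)
Definition gamma_perp w := forall v : nat -> H, gamma_orbit v -> inner (v 0%N) w = 0.

Lemma gamma_perpP w :
  (forall mu h, complex.Im mu != 0 -> inner (gam mu h) w = 0) -> gamma_perp w.
Proof.
move=> hw v; elim=> [mu h m0|a u1 u2 _ IH1 _ IH2]; first exact: hw.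
by rewrite innerDZl IH1 IH2 mulr0 addr0.
Qed.

Lemma gamma_perpE w mu h : gamma_perp w -> complex.Im mu != 0 -> inner (gam mu h) w = 0.
Proof. by move=> hw m0; exact: (hw _ (gamma_orbit_gen h m0)). Qed.

Lemma gamma_perp_linear a w w' : gamma_perp w -> gamma_perp w' -> gamma_perp (a *: w + w').
Proof. by move=> hw hw' v ov; rewrite innerDr innerZr hw // hw' // mulr0 addr0. Qed.

(** On the complement the factor is [t - 1] so that [t] minus the lift is the identity there;
    [1 <= t] keeps this factor within the bound [t]. *)
Definition lift_graph x y := exists (u : nat -> H) w, [/\ gamma_orbit u, gamma_perp w,
  x = u 0%N + w & y = u 1%N + (t - 1)%:C%C *: w].

Lemma lift_graph_linear a x y x' y' : lift_graph x y -> lift_graph x' y' ->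
  lift_graph (a *: x + x') (a *: y + y').
Proof.
move=> [u [w [ou pw -> ->]]] [u' [w' [ou' pw' -> ->]]].
exists (fun n => a *: u n + u' n), (a *: w + w'); split.
- exact: gamma_orbit_lin.
- exact: gamma_perp_linear.
- by rewrite scalerDr addrACA.
- by rewrite !scalerDr addrACA !scalerA mulrC.
Qed.

Lemma lift_graph_bound x y : lift_graph x y -> rnorm y <= t * rnorm x.
Proof.
move=> [u [w [ou pw -> ->]]]; have t0 := t_ge0.
rewrite -(ler_pXn2r (n := 2)) ?nnegrE ?mulr_ge0 ?rnorm_ge0 // exprMn.
have [v ov vS] := gamma_orbit_shift ou.
rewrite !pythagoras ?pw //; last by rewrite innerZr -vS pw // mulr0.
rewrite rnormZ rnormR exprMn mulrDr; apply: lerD.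
  by rewrite -exprMn ler_pXn2r ?nnegrE ?mulr_ge0 ?rnorm_ge0 //; exact: gamma_orbit_bound.
rewrite ler_wpM2r ?sqr_ge0 // real_normK ?num_real // ler_pXn2r ?nnegrE //; first by lra.
by rewrite subr_ge0.
Qed.

Lemma Im_i_neq0 : complex.Im ('i%C : R[i]) != 0.
Proof. by rewrite /= oner_eq0. Qed.

Lemma lift_graph_gamma mu h : complex.Im mu != 0 -> lift_graph (gam mu h) (gam mu (B h)).
Proof.
move=> m0; exists (fun n => gam mu (iter n B h)), 0; split.
- exact: gamma_orbit_gen.
- by move=> v _; rewrite inner0r.
- by rewrite addr0.
- by rewrite scaler0 addr0.
Qed.

Lemma lift_graph_perp w : gamma_perp w -> lift_graph w ((t - 1)%:C%C *: w).
Proof.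
move=> pw; have B0 := lin0 (adjoint_pair_linear B_sym).
have g0 := lin0 (gamma_linear Im_i_neq0).
exists (fun n => gam 'i%C (iter n B 0)), w; split=> //; first exact: (gamma_orbit_gen _ Im_i_neq0).
  by rewrite /= g0 add0r.
by rewrite /= B0 g0 add0r.
Qed.

(** A vector orthogonal to the domain is orthogonal to every [gam mu h], so it lies in the
    complement, which is part of the domain; it is then orthogonal to itself. *)
Lemma lift_graph_dense x : adherent [set x | exists y, lift_graph x y] x.
Proof.
apply: double_orthogonal_adherent.
  split.
    exists ((t - 1)%:C%C *: 0); apply: lift_graph_perp => v _; exact: inner0r.
  by move=> a u v [u' hu] [v' hv]; exists (a *: u' + v'); exact: lift_graph_linear.
move=> v hv; suff -> : v = 0 by rewrite inner0r.
have pv : gamma_perp v.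
  by apply: gamma_perpP => mu h m0; apply: hv; exists (gam mu (B h)); exact: lift_graph_gamma.
apply: inner_self_eq0; apply: hv; exists ((t - 1)%:C%C *: v); exact: lift_graph_perp.
Qed.

Lemma lift_exists : exists B' : H -> H,
  [/\ linear B', forall x, rnorm (B' x) <= t * rnorm x & forall x y, lift_graph x y -> B' x = y].
Proof.
exact: (bounded_extension t_ge0 lift_graph_linear lift_graph_bound lift_graph_dense).
Qed.

Section Lift.
Variable B' : H -> H.
Hypothesis B'_linear : linear B'.
Hypothesis B'_bound : forall x, rnorm (B' x) <= t * rnorm x.
Hypothesis B'_graph : forall x y, lift_graph x y -> B' x = y.

Lemma lift_gamma mu h : complex.Im mu != 0 -> B' (gam mu h) = gam mu (B h).
Proof. by move=> m0; apply/B'_graph/lift_graph_gamma. Qed.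

Lemma lift_perp w : gamma_perp w -> B' w = (t - 1)%:C%C *: w.
Proof. by move=> pw; apply/B'_graph/lift_graph_perp. Qed.

Lemma lift_total (f : H -> H) (c : R) : linear f ->
  (forall x, rnorm (f x) <= c * rnorm x) ->
  (forall mu h, complex.Im mu != 0 -> f (gam mu h) = 0) ->
  (forall w, gamma_perp w -> f w = 0) -> forall x, f x = 0.
Proof.
move=> lf bf fg fw x.
apply: (lipschitz_adherent (f := f) (c := c)) (lift_graph_dense x).
  by move=> u v; rewrite -(linB lf); exact: bf.
move=> y [z [u [w [ou pw -> _]]]]; rewrite (linD lf) (fw _ pw) addr0.
elim: ou => [mu h m0|a u1 u2 _ IH1 _ IH2]; first exact: fg.
by rewrite lf IH1 IH2 scaler0 addr0.
Qed.

Lemma lift_sym x y : inner (B' x) y = inner x (B' y).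
Proof.
have conjt : Num.conj ((t - 1)%:C%C : R[i]) = (t - 1)%:C%C by exact: conjc_real.
have graph_sym u v u' v' : lift_graph u u' -> lift_graph v v' -> inner u' v = inner u v'.
  move=> [p [w [op pw -> ->]]] [q [z [oq qz -> ->]]].
  have [p' op' p'S] := gamma_orbit_shift op; have [q' oq' q'S] := gamma_orbit_shift oq.
  rewrite !innerDl !innerDr !innerZl !innerZr conjt -p'S -q'S.
  rewrite (qz _ op) (qz _ op').
  rewrite (inner_conj w) (pw _ oq) (inner_conj w (q' 0%N)) (pw _ oq') conjC0.
  by rewrite p'S q'S (gamma_orbit_sym op oq) !mulr0 !addr0 !add0r.
have bil (u v : H) : rnorm (inner (B' u) v) <= t * rnorm v * rnorm u.
  by rewrite mulrAC; apply: le_trans (cauchy_schwarz _ _) _; rewrite ler_wpM2r ?rnorm_ge0.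
have bil' (u v : H) : rnorm (inner u (B' v)) <= t * rnorm v * rnorm u.
  by rewrite mulrC; apply: le_trans (cauchy_schwarz _ _) _; rewrite ler_wpM2l ?rnorm_ge0.
(* Symmetry passes from the graph to all of [H] in one variable at a time. *)
have half v v' : lift_graph v v' -> forall u, inner (B' u) v = inner u v'.
  move=> gv u; apply/eqP; rewrite -subr_eq0; apply/eqP.
  pose f u := inner (B' u) v - inner u v'; rewrite -[LHS]/(f u).
  apply: (lipschitz_adherent (f := f) (c := 2 * (t * rnorm v))) (lift_graph_dense u).
    move=> p q; have -> : f p - f q = inner (B' (p - q)) v - inner (p - q) v'.
      by rewrite /f (linB B'_linear) !innerBl; ring.
    apply: le_trans (rnormD _ _) _; rewrite rnormN -(B'_graph gv).
    by have := bil (p - q) v; have := bil' (p - q) v; lra.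
  by move=> p [p' gp]; rewrite /f (B'_graph gp) (graph_sym _ _ _ _ gp gv) subrr.
apply/eqP; rewrite -subr_eq0; apply/eqP.
pose f v := inner (B' x) v - inner x (B' v); rewrite -[LHS]/(f y).
apply: (lipschitz_adherent (f := f) (c := 2 * (t * rnorm x))) (lift_graph_dense y).
  move=> p q; have -> : f p - f q = inner (B' x) (p - q) - inner x (B' (p - q)).
    by rewrite /f (linB B'_linear) !innerBr; ring.
  apply: le_trans (rnormD _ _) _; rewrite rnormN.
  have h1 : rnorm (inner (B' x) (p - q)) <= t * rnorm x * rnorm (p - q).
    by apply: le_trans (cauchy_schwarz _ _) _; rewrite ler_wpM2r ?rnorm_ge0.
  have h2 : rnorm (inner x (B' (p - q))) <= t * rnorm x * rnorm (p - q).
    apply: le_trans (cauchy_schwarz _ _) _; rewrite [t * _]mulrC -mulrA.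
    by rewrite ler_wpM2l ?rnorm_ge0.
  lra.
by move=> v [v' gv]; rewrite /f (half _ _ gv) (B'_graph gv) subrr.
Qed.

Lemma gamma_limit (f : H -> H) (c : R) mu h : complex.Im mu != 0 -> linear f ->
  (forall x, rnorm (f x) <= c * rnorm x) ->
  (forall lam, complex.Im lam != 0 -> lam != mu -> f (gam lam h) = 0) -> f (gam mu h) = 0.
Proof.
move=> m0 lf bf hf.
apply: (lipschitz_adherent (f := f) (c := c) (E := [set x | f x = 0])) => //.
  by move=> u v; rewrite -(linB lf); exact: bf.
move=> e e0; have [lam [l0 lm hl _]] := gamma_approx h h m0 e0.
by exists (gam lam h); split=> //; exact: hf.
Qed.

(** Moved to the other side, the resolvent acts on [gam nu h], and [resolvent_gamma] keeps the
    result in the span. The point where that formula divides by zero is reached as a limit. *)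
Lemma resolvent_perp mu w : complex.Im mu != 0 -> gamma_perp w -> gamma_perp (resolvent mu w).
Proof.
move=> m0 pw; have m0' : complex.Im (Num.conj mu) != 0 by rewrite Im_conjC oppr_eq0.
have off nu h : complex.Im nu != 0 -> nu != Num.conj mu ->
    inner (gam nu h) (resolvent mu w) = 0.
  move=> n0 nm; rewrite -{1}[mu]conjCK -resolvent_adjoint // resolvent_gamma // 1?eq_sym //.
  by rewrite innerZl innerBl !gamma_perpE // subrr mulr0.
apply: gamma_perpP => lam h l0.
have [->|] := eqVneq lam (Num.conj mu); last exact: off.
rewrite inner_conj -[RHS]conjC0 -(inner0l (gam (Num.conj mu) h)); congr Num.conj.
apply: inner_approx => e e0; have [nu [n0 nm hn _]] := gamma_approx h h m0' e0.
exists (gam nu h), (gam nu h); split=> //.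
by rewrite inner0l inner_conj off // conjC0.
Qed.

(** The commutator vanishes on [gam lam h] by [resolvent_gamma], and on the complement because [B']
    is a scalar there and the resolvent preserves it. *)
Lemma lift_resolvent mu x : complex.Im mu != 0 ->
  B' (resolvent mu x) = resolvent mu (B' x).
Proof.
move=> m0; have lr := resolvent_linear m0.
set r := `|complex.Im mu|^-1; have r0 : 0 <= r by rewrite invr_ge0.
pose f x := B' (resolvent mu x) - resolvent mu (B' x).
have lf : linear f.
  move=> a u v; rewrite /f lr !B'_linear lr opprD addrACA.
  by rewrite -scalerBr.
have bf u : rnorm (f u) <= 2 * (t * r) * rnorm u.
  apply: le_trans (rnormD _ _) _; rewrite rnormN.
  have h1 : rnorm (B' (resolvent mu u)) <= t * (r * rnorm u).
    by apply: le_trans (B'_bound _) _; rewrite ler_wpM2l // resolvent_bound.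
  have h2 : rnorm (resolvent mu (B' u)) <= r * (t * rnorm u).
    by apply: le_trans (resolvent_bound _ m0) _; rewrite ler_wpM2l.
  by lra.
suff f0 : f x = 0 by apply/eqP; rewrite -subr_eq0; apply/eqP.
have off lam h : complex.Im lam != 0 -> lam != mu -> f (gam lam h) = 0.
  move=> l0 lm; rewrite /f lift_gamma // !resolvent_gamma // 1?eq_sym //.
  by rewrite (linZ B'_linear) (linB B'_linear) !lift_gamma // subrr.
apply: (lift_total lf bf) => [lam h l0|w pw]; last first.
  rewrite /f (lift_perp pw) (linZ lr) (lift_perp (resolvent_perp m0 pw)).
  by rewrite subrr.
have [->|] := eqVneq lam mu; last exact: off.
by apply: (gamma_limit m0 lf bf) => nu n0 nm; exact: off.
Qed.

(** Split [y] into a vector of [kerGamma0], which is a value of the resolvent, and a vector of the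
    defect subspace at [i]; [B'] is under control on each. *)
Lemma lift_adj y : dom S' y -> dom S' (B' y) /\ S' (B' y) = B' (S' y).
Proof.
move=> dy; have [dg eg g0] := gammaP (Gamma0 y) Im_i_neq0.
set g := gam 'i%C (Gamma0 y) in dg eg g0.
have kz : kerGamma0 (y - g).
  split; first exact: (subspB adj_linear_set dy dg).
  by rewrite (lin_onB adj_linear_set Gamma0_linear) // g0 subrr.
set z := S' (y - g) - 'i%C *: (y - g).
have yz : resolvent 'i%C z = y - g by exact: (resolvent_eq Im_i_neq0 kz).
have [[dr _] hr] := resolventP (B' z) Im_i_neq0.
have eB : B' (y - g) = resolvent 'i%C (B' z) by rewrite -yz (lift_resolvent _ Im_i_neq0).
have [dB eBg] : dom S' (B' g) /\ S' (B' g) = B' (S' g).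
  have [d1 e1 _] := gammaP (B (Gamma0 y)) Im_i_neq0.
  by rewrite eg (linZ B'_linear) (lift_gamma _ Im_i_neq0).
have [dB' eB'] : dom S' (B' (y - g)) /\ S' (B' (y - g)) = B' (S' (y - g)).
  rewrite eB; split=> //; rewrite -[LHS](subrK ('i%C *: resolvent 'i%C (B' z))) hr.
  by rewrite -eB -(linZ B'_linear) -(linD B'_linear) subrK.
have -> : y = (y - g) + g by rewrite subrK.
rewrite (linD B'_linear); split; first exact: (subspD adj_linear_set dB' dB).
rewrite (lin_onD adj_linear) // eB' eBg -(linD B'_linear).
by rewrite -(lin_onD adj_linear) //; case: kz.
Qed.

(** A symmetric bounded operator commuting with [S'] commutes with its adjoint, and that is [S]. *)
Lemma lift_commutes x : dom S x -> dom S (B' x) /\ S (B' x) = B' (S x).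
Proof.
move=> dx; apply: double_adjoint => y dy; have [dB eB] := lift_adj dy.
by rewrite !lift_sym -eB (adjointP dB).
Qed.

End Lift.
End Lifting.

(* With [B = t - calJ T] and its lift [B'], the operator [J (t - B')] is the
   required C-symmetry; it equals [J] on the part where [S] is self-adjoint. *)
Lemma C_symmetry_lift (T : G -> G) : C_operator calJ T ->
  (forall mu h, complex.Im mu != 0 -> Gamma1 (gam mu (T h)) = T (Gamma1 (gam mu h))) ->
  exists X, [/\ C_operator J X, commutes S X & forall h, X (gam 'i%C h) = gam 'i%C (T h)].
Proof.
move=> [/bounded_operatorP [lT [c [c0 bT]]] TT JT] wT.
have [symW posW] := positive_operatorE JT.
(* [c] already bounds [calJ T], as [calJ] is isometric; adding 1 ensures [1 <= t], needed on the
   complement. *)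
set t := c + 1; have t1 : 1 <= t by rewrite /t; lra.
have t0 : 0 <= t by rewrite /t; lra.
have conjt : Num.conj (t%:C%C : R[i]) = t%:C%C by exact: conjc_real.
have bW h : rnorm ((calJ \o T) h) <= t * rnorm h.
  rewrite /= (J_isometry calJ_sym calJ_inv); apply: le_trans (bT h) _.
  by rewrite ler_wpM2r ?rnorm_ge0 // /t; lra.
pose B h := t%:C%C *: h - (calJ \o T) h.
have bB : forall h, rnorm (B h) <= t * rnorm h by exact: (complement_bound symW t0 posW bW).
have symB h k : inner (B h) k = inner h (B k).
  by rewrite /B innerBl innerBr innerZl innerZr symW conjt.
have lJ := adjoint_pair_linear symmetry_sym.
have gJ mu h : complex.Im mu != 0 -> J (gam mu h) = gam mu (calJ h).
  by move=> m0; exact: (gamma_commutes h m0 lJ adj_symmetry calJ0).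
have wB mu h : complex.Im mu != 0 -> Gamma1 (gam mu (B h)) = B (Gamma1 (gam mu h)).
  move=> m0; have lg := gamma_linear m0.
  have [dh _ _] := gammaP h m0; have [dW _ _] := gammaP (calJ (T h)) m0.
  have [dT _ _] := gammaP (T h) m0.
  rewrite /B (linB lg) (linZ lg) (lin_onB adj_linear_set Gamma1_linear) //; last first.
    exact: (subspZ adj_linear_set _ dh).
  rewrite (lin_onZ adj_linear_set Gamma1_linear) //= -gJ // -calJ1 // wT //.
have [B' [lB' bB' gB']] := lift_exists symB t1 bB wB.
have symB' := lift_sym symB wB lB' bB' gB'.
have comB' := lift_commutes symB t1 wB lB' bB' gB'.
pose Th x := t%:C%C *: x - B' x; pose X x := J (Th x).
have symTh x y : inner (Th x) y = inner x (Th y).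
  by rewrite /Th innerBl innerBr innerZl innerZr symB' conjt.
have lTh := adjoint_pair_linear symTh.
have posTh x : 0 <= complex.Re (inner (Th x) x).
  apply: (positive_of_complement (T := Th) (t := t)) => y.
  by rewrite /Th opprB addrC subrK.
have Th_gam mu h : complex.Im mu != 0 -> Th (gam mu h) = gam mu (calJ (T h)).
  move=> m0; have lg := gamma_linear m0.
  rewrite /Th (lift_gamma gB') // /B (linB lg) (linZ lg).
  by rewrite opprB addrC subrK.
have Th_perp w : gamma_perp B w -> Th w = w.
  move=> pw; rewrite /Th (lift_perp symB gB' pw) -scalerBl.
  by rewrite -real_complexN -real_complexD (_ : t + - (t - 1) = 1) ?scale1r //; ring.
have bTh x : rnorm (Th x) <= 2 * t * rnorm x.
  apply: le_trans (rnormD _ _) _; rewrite rnormN rnormZ rnormR ger0_norm //.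
  by have := bB' x; lra.
have lX : linear X by move=> a x y; rewrite /X lTh lJ.
have bX x : rnorm (X x) <= 2 * t * rnorm x by rewrite /X (J_isometry symmetry_sym symmetry_inv).
have XX : X \o X =1 id.
  move=> x; pose f x := X (X x) - x.
  have lf : linear f by move=> a u v; rewrite /f lX lX scalerBr opprD addrACA.
  suff : f x = 0 by move/eqP; rewrite subr_eq0 => /eqP.
  apply: (lift_total t symB (c := 2 * t * (2 * t) + 1) lf).
  - move=> u; apply: le_trans (rnormD _ _) _; rewrite rnormN mulrDl mul1r lerD2r.
    by apply: le_trans (bX _) _; rewrite -[leRHS]mulrA ler_wpM2l // mulr_ge0.
  - move=> mu h m0; rewrite /f /X !Th_gam // !gJ // ![calJ (calJ _)]calJ_inv.
    by rewrite Th_gam // gJ // [calJ (calJ _)]calJ_inv [T (T _)]TT subrr.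
  - move=> w pw; have pJw : gamma_perp B (J w).
      by apply: gamma_perpP => mu h m0; rewrite -symmetry_sym gJ // (gamma_perpE _ pw).
    by rewrite /f /X Th_perp // Th_perp // [J (J w)]symmetry_inv subrr.
exists X; split.
- split=> //.
    apply/bounded_operatorP; split=> //; exists (2 * t); split=> //; exact: mulr_ge0.
  have JX x : (J \o X) x = Th x by rewrite /= /X [J (J _)]symmetry_inv.
  apply: positive_operatorI => [x y|x y /= exy|x]; rewrite ?JX //.
  suff : X x = X y by move=> e; rewrite -[x]XX -[y]XX /= e.
  by rewrite -[X x]symmetry_inv -[X y]symmetry_inv /= exy.
- apply: commutes_involution => // x dx.
  have [dB eB] := comB' x dx.
  have [dT eT] : dom S (Th x) /\ S (Th x) = Th (S x).
    have dtx : dom S (t%:C%C *: x) by exact: (subspZ dom_linear_set _ dx).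
    split; first exact: (subspB dom_linear_set dtx dB).
    rewrite (lin_onB dom_linear_set dom_linear_on) // eB.
    by rewrite (lin_onZ dom_linear_set dom_linear_on).
  by have [dJ eJ] := commutes_dom SJ dT; rewrite eJ eT.
- by move=> h; rewrite /X (Th_gam _ _ Im_i_neq0) (gJ _ _ Im_i_neq0) [calJ (calJ _)]calJ_inv.
Qed.

End BoundaryTriplet.

Section StableExtensions.
Context {R : realType} {H G : hilbertType R} (S : operator H) (Gamma0 Gamma1 : H -> G).
Hypothesis S_dense : densely_defined S.
Hypothesis S_symmetric : symmetric_operator S.
Hypothesis Gamma_triplet : boundary_triplet S Gamma0 Gamma1.

Lemma weyl_gamma (M : R[i] -> G -> G) mu h : weyl_function S Gamma0 Gamma1 M ->
  complex.Im mu != 0 -> M mu h = Gamma1 (gamma_field S Gamma0 mu h).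
Proof.
move=> MW m0; have [dg eg g0] := gammaP S_dense S_symmetric Gamma_triplet h m0.
have m1 : mu \isn't Num.real by rewrite nonrealE.
by have [_ /(_ _ (conj dg eg))] := MW mu m1; rewrite g0.
Qed.

Lemma extension_commutes (A : operator H) (K T : G -> G) (X : H -> H) :
  opeq A (oprestr (adjoint S)
    [set f | K (Omega_plus Gamma0 Gamma1 f) = Omega_minus Gamma0 Gamma1 f]) ->
  linear T -> commutes (everywhere K) T -> X \o X =1 id ->
  (forall y, dom (adjoint S) y ->
     dom (adjoint S) (X y) /\ adjoint S (X y) = X (adjoint S y)) ->
  (forall f, dom (adjoint S) f -> T (Gamma0 f) = Gamma0 (X f)) ->
  (forall f, dom (adjoint S) f -> T (Gamma1 f) = Gamma1 (X f)) ->
  commutes A X.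
Proof.
move=> [[sA eA] [sA' _]] lT /commutes_everywhere KT XX cX T0 T1.
apply: commutes_involution => // x dx; have [dx' hx] := sA x dx.
have [dX eX] := cX x dx'.
have [Tp Tm] := @Omega_commutes R H G Gamma0 Gamma1 X T x lT (T0 x dx') (T1 x dx').
have dXA : dom A (X x) by apply: sA'; split=> //=; rewrite -Tp -Tm KT hx.
by split=> //; have := eA _ dXA; have := eA _ dx => /= <- <-.
Qed.

End StableExtensions.

Theorem theorem3p20 (R : realType) (H : hilbertType R)
    (S : operator H) (J : H -> H)
    (S_linear : linear_operator S) (S_closed : closed_operator S)
    (S_dense : densely_defined S) (S_symmetric : symmetric_operator S)
    (S_defect : equal_defect_numbers S)
    (J_symmetry : fundamental_symmetry J) (J_nontrivial : nontrivial_symmetry J)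
    (SJ : commutes S J)
    (D : Type) (C : D -> H -> H)
    (C_all : range C = [set C' | C_symmetry J S C'])
    (G : hilbertType R) (Gamma0 Gamma1 : H -> G)
    (Gamma_triplet : boundary_triplet S Gamma0 Gamma1)
    (calC : D -> G -> G)
    (calC0 : forall (alpha : D) (f : H), dom (adjoint S) f ->
       calC alpha (Gamma0 f) = Gamma0 (C alpha f))
    (calC1 : forall (alpha : D) (f : H), dom (adjoint S) f ->
       calC alpha (Gamma1 f) = Gamma1 (C alpha f))
    (alphaJ : D) (C_alphaJ : C alphaJ = J)
    (calJ : G -> G) (calJ_def : calJ = calC alphaJ)
    (M : R[i] -> G -> G) (M_weyl : weyl_function S Gamma0 Gamma1 M)
    (A : operator H) :
  Sigma_J_st J S C A <->
  exists K : G -> G,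
    [/\ J_unitary calJ K,
        opeq A (oprestr (adjoint S)
          [set f | K (Omega_plus Gamma0 Gamma1 f) = Omega_minus Gamma0 Gamma1 f])
      & exists calC' : G -> G,
        [/\ C_operator calJ calC', commutes (everywhere K) calC'
          & forall lambda : R[i], lambda \isn't Num.real ->
              commutes (everywhere (M lambda)) calC']].
Proof.
have J0 : forall f, dom (adjoint S) f -> calJ (Gamma0 f) = Gamma0 (J f).
  by move=> f df; rewrite calJ_def calC0 // C_alphaJ.
have J1 : forall f, dom (adjoint S) f -> calJ (Gamma1 f) = Gamma1 (J f).
  by move=> f df; rewrite calJ_def calC1 // C_alphaJ.
have CS alpha : C_symmetry J S (C alpha).
  by have : range C (C alpha) by [exists alpha]; rewrite C_all.
split=> [[AS [alpha AC]]|[K [KJ AK [T [TC KT MT]]]]].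
  have [CC SC] := CS alpha; have [c0 c1] := (calC0 alpha, calC1 alpha).
  have TC := image_C_operator S_dense S_symmetric Gamma_triplet J_symmetry SJ J0 J1 CC SC c0 c1.
  have [K [KJ AK KT]] :=
    stable_extension_J_unitary S_dense Gamma_triplet J_symmetry SJ J0 J1 AS AC TC c0 c1.
  exists K; split=> //; exists (calC alpha); split=> // mu; rewrite nonrealE => m0.
  apply/commutes_everywhere => h.
  rewrite !(weyl_gamma S_dense S_symmetric Gamma_triplet _ M_weyl m0).
  exact: (weyl_commutes S_dense S_symmetric Gamma_triplet J_symmetry SJ CC SC c0 c1 h m0).
split.
  exact: (J_unitary_extension S_linear S_dense S_symmetric Gamma_triplet J_symmetry SJ J0 J1 KJ AK).
have weylT mu h : complex.Im mu != 0 -> Gamma1 (gamma_field S Gamma0 mu (T h)) =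
    T (Gamma1 (gamma_field S Gamma0 mu h)).
  move=> m0; rewrite -!(weyl_gamma S_dense S_symmetric Gamma_triplet _ M_weyl m0).
  have mR : mu \isn't Num.real by rewrite nonrealE.
  exact: ((commutes_everywhere _ _).1 (MT _ mR)).
have [X [XC SX Xg]] := C_symmetry_lift S_linear S_closed S_dense S_symmetric
  Gamma_triplet J_symmetry SJ J0 J1 TC weylT.
have [alpha _ CX] : range C X by rewrite C_all; split.
(* The lift knows [T] only through the defect subspace at [i]. As [Gamma0] inverts [gam] there, [T]
   is the member of the given family attached to [X], and so intertwines both boundary maps on all
   of [dom (adjoint S)]. *)
have calCT : calC alpha = T.
  apply/funext => h.
  have [dg _ g0] := gammaP S_dense S_symmetric Gamma_triplet h (Im_i_neq0 (R := R)).
  have [_ _ gT] := gammaP S_dense S_symmetric Gamma_triplet (T h) (Im_i_neq0 (R := R)).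
  by rewrite -{1}g0 calC0 // CX Xg gT.
exists alpha; have [bT _ _] := TC; have [_ XX _] := XC; rewrite CX.
apply: (extension_commutes AK bT.1 KT XX).
- exact: (adj_C_symmetry S_dense J_symmetry SJ XC SX).
- by move=> f df; rewrite -calCT calC0 // CX.
- by move=> f df; rewrite -calCT calC1 // CX.
Qed.
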